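(* There is an algorithm that, given a 2-connected graph $G$ with $n$ nodes and $m$ edges that has no $K_2$-cutset, outputs YES if $G\in\mathcal C_1$ and NO otherwise, in time $\mathcal O(nm)$.
   Context: All graphs are finite, simple and undirected. A propeller $(C,x)$ is a graph consisting of a chordless cycle $C$ (the rim) and a node $x\notin V(C)$ (the center) that has at least two neighbors on $C$. $\mathcal C_1$ is the class of graphs that do not contain a propeller as a subgraph. A graph is 2-connected if removing fewer than 2 nodes never leaves a disconnected graph or a single node. A $K_2$-cutset is a set $\{a,b\}$ with $ab\in E(G)$ such that $G\setminus\{a,b\}$ is disconnected. *)

(* Defs.v *)
From mathcomp Require Import all_boot.
Set Implicit Arguments.
Unset Strict Implicit.
Unset Printing Implicit Defensive.

Record sgraph := SGraph {
  node :> finType;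
  adj : rel node;
  adj_sym : symmetric adj;
  adj_irr : irreflexive adj }.

Definition edges (G : sgraph) : {set {set G}} :=
  [set [set p.1; p.2] | p : G * G & adj p.1 p.2].

Section Deletion.
Variables (G : sgraph) (S : {set G}).

Definition del_node : finType := {x : G | x \notin S}.
Definition del_adj : rel del_node := fun u v => adj (val u) (val v).

Lemma del_adj_sym : symmetric del_adj.
Proof. by move=> u v; apply: adj_sym. Qed.

Lemma del_adj_irr : irreflexive del_adj.
Proof. by move=> u; apply: adj_irr. Qed.

(* The graph G \ S, induced by the complement of S. *)
Definition del : sgraph := SGraph del_adj_sym del_adj_irr.
End Deletion.

(* The graph without nodes counts as disconnected; hence a 2-connected graph
   has at least three nodes. *)
Definition connected (G : sgraph) : Prop :=
  0 < #|G| /\ forall x y : G, connect (@adj G) x y.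

Definition two_connected (G : sgraph) : Prop :=
  forall S : {set G}, #|S| < 2 -> connected (del S) /\ #|del S| <> 1.

Definition K2_cutset (G : sgraph) (a b : G) : Prop :=
  adj a b /\ ~ connected (del [set a; b]).

Definition chordless_cycle (G : sgraph) (C : seq G) : Prop :=
  [/\ 2 < size C, ucycle (@adj G) C &
      {in C &, forall u v, adj u v -> next C u = v \/ next C v = u}].

Definition propeller (H : sgraph) (C : seq H) (x : H) : Prop :=
  [/\ chordless_cycle C, x \notin C, forall y : H, y = x \/ y \in C &
      1 < #|[set y in C | adj x y]|].

(* Not necessarily induced: the rim of a propeller contained in G in this
   sense may have chords in G. *)
Definition subgraph (H G : sgraph) : Prop :=
  exists2 f : H -> G, injective f & forall u v, adj u v -> adj (f u) (f v).

Definition class_C1 (G : sgraph) : Prop :=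
  ~ exists (H : sgraph) (C : seq H) (x : H), propeller C x /\ subgraph H G.

(* Model of computation: structured programs for a random access machine whose
   memory consists of variables and arrays (indexed by nat, only finitely many
   of which occur in a given program) holding natural numbers. Every operation
   has unit cost. The successor being the only operation that creates larger
   numbers, every number in memory is bounded by the largest constant of the
   program or number of the input, plus the number of steps made so far, so that
   unit cost does not hide any computation on long integers. *)
Inductive expr :=
  | Const of nat
  | Var of nat
  | Get of nat & expr
  | Succ of expr
  | Pred of expr.

Inductive test :=
  | Eq of expr & expr
  | Lt of expr & expr
  | Not of test
  | And of test & test.

Inductive prog :=
  | Skip
  | Assign of nat & expr
  | Put of nat & expr & expr
  | Seq of prog & prog
  | If of test & prog & prog
  | While of test & prog.

Record memory := Memory { vars : nat -> nat; arrs : nat -> nat -> nat }.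

Definition upd T (f : nat -> T) (i : nat) (v : T) : nat -> T :=
  fun j => if j == i then v else f j.

Definition set_var (s : memory) (x v : nat) : memory :=
  Memory (upd (vars s) x v) (arrs s).

Definition set_cell (s : memory) (a i v : nat) : memory :=
  Memory (vars s) (upd (arrs s) a (upd (arrs s a) i v)).

Fixpoint eval (s : memory) (e : expr) : nat :=
  match e with
  | Const k => k
  | Var x => vars s x
  | Get a i => arrs s a (eval s i)
  | Succ e => (eval s e).+1
  | Pred e => (eval s e).-1
  end.

Fixpoint ecost (e : expr) : nat :=
  match e with
  | Const _ | Var _ => 1
  | Get _ e | Succ e | Pred e => (ecost e).+1
  end.

Fixpoint holds (s : memory) (b : test) : bool :=
  match b with
  | Eq e f => eval s e == eval s f
  | Lt e f => eval s e < eval s f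
  | Not b => ~~ holds s b
  | And b c => holds s b && holds s c
  end.

Fixpoint tcost (b : test) : nat :=
  match b with
  | Eq e f | Lt e f => (ecost e + ecost f).+1
  | Not b => (tcost b).+1
  | And b c => (tcost b + tcost c).+1
  end.

(* run p s t s' : started in memory s, the program p halts after exactly t
   elementary operations, in memory s'. *)
Inductive run : prog -> memory -> nat -> memory -> Prop :=
  | RunSkip s : run Skip s 1 s
  | RunAssign x e s :
      run (Assign x e) s (ecost e).+1 (set_var s x (eval s e))
  | RunPut a i e s :
      run (Put a i e) s (ecost i + ecost e).+1
        (set_cell s a (eval s i) (eval s e))
  | RunSeq p q s t s1 u s2 :
      run p s t s1 -> run q s1 u s2 -> run (Seq p q) s (t + u) s2
  | RunIfT b p q s t s1 :
      holds s b -> run p s t s1 -> run (If b p q) s (tcost b + t).+1 s1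
  | RunIfF b p q s t s1 :
      ~~ holds s b -> run q s t s1 -> run (If b p q) s (tcost b + t).+1 s1
  | RunWhileT b p s t s1 u s2 :
      holds s b -> run p s t s1 -> run (While b p) s1 u s2 ->
      run (While b p) s (tcost b + t + u).+1 s2
  | RunWhileF b p s :
      ~~ holds s b -> run (While b p) s (tcost b).+1 s.

(* A presentation of G by adjacency lists: vs lists the nodes, and N v lists the
   neighbours of v, both in arbitrary order and without repetition. *)
Definition presentation (G : sgraph) (vs : seq G) (N : G -> seq G) : Prop :=
  [/\ uniq vs, forall x : G, x \in vs &
      forall v, uniq (N v) /\ N v =i [pred w | adj v w]].

(* A node is represented by its index in vs. *)
Definition rows (G : sgraph) (vs : seq G) (N : G -> seq G) : seq (seq nat) :=
  [seq [seq index w vs | w <- N v] | v <- vs].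

(* Variable 0 holds the number of nodes; array 1 is the concatenation of the
   adjacency lists of the nodes 0, 1, ..., the list of node i occupying the
   cells from arrs 0 i (included) to arrs 0 i.+1 (excluded). The rest of the
   memory is 0. *)
Definition input (G : sgraph) (vs : seq G) (N : G -> seq G) : memory :=
  let L := rows vs N in
  Memory
    (fun x => if x is 0 then size vs else 0)
    (fun a i => match a with
                | 0 => sumn (take i (map size L))
                | 1 => nth 0 (flatten L) i
                | _ => 0
                end).

Definition YES := 1.
Definition NO := 0.

Definition output (s : memory) : nat := vars s 0.

(* Main.v *)
(* A propeller subgraph of G amounts to a node x and two neighbours of x on a
   common cycle of G - x, i.e. (Whitney) in a common block of G - x with at
   least three nodes. For every x the program computes a depth-first search tree
   of G rooted at x, then the lowpoints with respect to the edges of G - x. These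
   split the tree edges of G - x into its blocks: the edge from v to its parent
   belongs to the same block as the edge above it if and only if
   low v < num (par v). A block is represented by the topmost node h that is not
   its root, and has a cycle if and only if low h <= num (par h). The answer is
   NO when some such block contains two neighbours of x. One x costs O(n + m),
   and n <= 2 m since every node has a neighbour. *)
Require Import Defs.
From mathcomp Require Import all_boot zify.
Set Implicit Arguments.
Unset Strict Implicit.
Unset Printing Implicit Defensive.

(** * Two nodes on a common cycle *)

(** A propeller need only be a subgraph, so the chords of a cycle may be thrown away before it
    serves as a rim; this is why any common cycle will do, chordless or not. The search is run on
    the whole of [G] because its edges join only comparable nodes: removing the root [x] leaves a
    search forest of [G - x], with one tree for each child of [x]. A child of [x] still opens a
    group of nodes whose top is [x], but its lowpoint exceeds [num x], so this group never passes
    the test for a cycle. Blocks are never defined as maximal sets. Instead, a group that passes the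
    test is shown to stay connected when any one node is deleted, and each cycle avoiding [x] is
    shown to lie inside one such group. The obstacle is the top of a group: it belongs to the group
    although its own parent edge does not, and it may be the top of many groups. A table from nodes
    to groups misses it, so the program counts it at the moment when a group is opened. *)

Section CyclesThroughTwoNodes.
Variables (T : finType) (e : rel T).
Hypotheses (e_sym : symmetric e) (e_irr : irreflexive e).

Definition within (B : pred T) : rel T := fun a b => [&& e a b, B a & B b].

Definition without (B : pred T) w : pred T := fun y => (y != w) && B y.

Lemma within_sym B : symmetric (within B).
Proof. by move=> a b; rewrite /within e_sym [B a && _]andbC. Qed.

Definition nonseparable (B : pred T) :=
  forall w a b, B a -> B b -> a != w -> b != w ->
    connect (within (without B w)) a b.

Definition cocyclic (B : pred T) (u v : T) :=
  exists C, [/\ ucycle e C, 2 < size C, all B C, u \in C & v \in C].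

Lemma path_within (B : pred T) a p : path (within B) a p -> path e a p /\ all B p.
Proof.
elim: p a => //= b p IH a /andP[/and3P[eab _ Bb] /IH[ep Bp]].
by rewrite eab Bb.
Qed.

(** Deleting [v] leaves a path from [u] to [z], and deleting [u] leaves one from [z] to [v]; neither
    uses the edge [u v]. A path from [u] to [v] extracted from their union closes up with that edge,
    and it has an inner node because the edge itself is excluded. *)
Lemma cocyclic_edge (B : pred T) u v z :
  nonseparable B -> e u v -> B u -> B v -> B z -> z != u -> z != v ->
  cocyclic B u v.
Proof.
move=> nsB euv Bu Bv Bz zu zv.
pose r := [rel a b | [&& e a b, B a, B b, (a, b) != (u, v) & (a, b) != (v, u)]].
have sub w : w \in [:: u; v] -> subrel (within (without B w)) r.
  move=> wuv a b /and3P[eab /andP[aw Ba] /andP[bw Bb]].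
  rewrite /= eab Ba Bb !xpair_eqE.
  move: wuv aw bw; rewrite !inE => /orP[] /eqP -> /negPf-> /negPf->;
    by rewrite !andbF.
have uv : u != v by apply: contraTN euv => /eqP ->; rewrite e_irr.
have cuz : connect r u z.
  have:= nsB v u z Bu Bz uv zv; apply: connect_sub => a b ab.
  by apply/connect1/(sub v) => //; rewrite !inE eqxx orbT.
have czv : connect r z v.
  have vu : v != u by rewrite eq_sym.
  have:= nsB u z v Bz Bv zu vu; apply: connect_sub => a b ab.
  by apply/connect1/(sub u) => //; rewrite !inE eqxx.
have /connectP[p0 rp0 lp0] := connect_trans cuz czv.
case/shortenP: rp0 lp0 => p rp up _ lp; exists (u :: p).
have [ep Bp] : path e u p /\ all B p.
  suff /path_within : path (within B) u p by [].
  by apply: sub_path rp => a b /and5P[eab Ba Bb _ _]; rewrite /within eab Ba.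
split; rewrite ?mem_head //.
- rewrite /ucycle /= rcons_path ep -lp e_sym euv /=.
  by have /= := up.
- case: p rp lp {up ep Bp} => [|a [|b p]] //=; first by move=> _ /eqP; rewrite eq_sym (negPf uv).
  by move=> /[swap] <-; rewrite eqxx /= !andbF.
- by rewrite /= Bu.
- by rewrite lp mem_last.
Qed.

(** The arc [p1] of the cycle is exchanged for a detour from [w] through [v] and [s] that meets the
    cycle again only at [x]. *)
Lemma reroute w v s x p1 p2 :
  ucycle e (w :: p1 ++ x :: p2) -> e w v -> path e v (rcons s x) ->
  uniq (v :: s) -> all (fun y => y \notin w :: p1 ++ x :: p2) (v :: s) ->
  ucycle e (w :: v :: s ++ x :: p2).
Proof.
move=> /andP[+ uC] wv vx uvs dis; rewrite /= rcons_cat cat_path /= => /and3P[_ _ p2w].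
apply/andP; split.
  by rewrite /= wv -cat1s catA cats1 rcons_cat cat_path last_rcons vx.
have sub : subseq (w :: x :: p2) (w :: p1 ++ x :: p2).
  by rewrite /= eqxx suffix_subseq.
rewrite -[w :: _]/([:: w] ++ (v :: s) ++ (x :: p2)) uniq_catCA cat_uniq uvs.
rewrite (subseq_uniq sub uC) andbT; apply/hasPn => y /(mem_subseq sub) yC.
by apply: contraL yC => /(allP dis).
Qed.

(** If [v] is off [C], walk from [v] towards [u], avoiding [w], up to the first node [x] of [C].
    This detour and the edge [w v] replace one of the two arcs of [C] between [w] and [x]; the arc
    containing [u] is kept. *)
Lemma cocyclic_step (B : pred T) u w v :
  nonseparable B -> cocyclic B u w -> e w v -> B v -> u != w ->
  cocyclic B u v.
Proof.
move=> nsB [C [uC sC BC uinC winC]] ewv Bv uw.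
have [vC|vC] := boolP (v \in C); first by exists C.
have vw : v != w by apply: contraNneq vC => ->.
have /connectP[p0 rp0 lp0] := nsB w v u Bv (allP BC _ uinC) vw uw.
case/shortenP: rp0 lp0 => p rp up _ lp.
have hp : has (mem C) p.
  apply/hasP; exists u => //=; rewrite lp.
  by have := mem_last v p; rewrite inE -lp => /orP[/eqP uv|//]; rewrite -uv uinC in vC.
move: rp up {lp}; case/split_find: hp => x s s2 xC sC' rp up.
have {rp} [vsx /allP Bsx] : path e v (rcons s x) /\ all (without B w) (rcons s x).
  by apply: path_within; move: rp; rewrite cat_path => /andP[].
have /andP[xw Bx] := Bsx x ltac:(by rewrite mem_rcons mem_head).
have uvs : uniq (v :: s).
  by move: up; rewrite -cat_cons -rcons_cons cat_uniq rcons_uniq => /andP[/andP[]].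
have [i q Cq] := rot_to winC.
have memq y : (y \in w :: q) = (y \in C) by rewrite -Cq mem_rot.
have ucq : ucycle e (w :: q) by rewrite -Cq /ucycle rot_cycle rot_uniq.
have Bq : all B (w :: q) by apply/allP => y; rewrite memq => /(allP BC).
have dis : all (fun y => y \notin w :: q) (v :: s).
  apply/allP => y; rewrite memq inE => /orP[/eqP -> //|ys].
  by apply: contra sC' => yC; apply/hasP; exists y.
have xq : x \in q by move: xC; rewrite /= -memq inE (negPf xw).
have uq : u \in q by move: uinC; rewrite -memq inE (negPf uw).
have Bs : all B (v :: s).
  apply/allP => y; rewrite inE => /orP[/eqP -> //|ys].
  by have /andP[] := Bsx y ltac:(by rewrite mem_rcons inE ys orbT).
(* Stated for any listing of [C] that starts at [w], so that it serves both orientations of the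
   cycle. *)
have conclude p1 p2 : ucycle e (w :: p1 ++ x :: p2) ->
    (forall y, (y \in w :: p1 ++ x :: p2) = (y \in w :: q)) -> u \in x :: p2 ->
    cocyclic B u v.
  move=> uc mem ux; exists (w :: v :: s ++ x :: p2); split.
  - apply: (reroute uc) => //; apply: sub_all dis => y; by rewrite mem.
  - by rewrite /= size_cat /= addnS.
  - have sub y : y \in x :: p2 -> B y.
      by move=> yp; apply: (allP Bq); rewrite -mem inE mem_cat yp !orbT.
    rewrite /= (allP BC w winC) all_cat /=.
    by move: Bs => /= /andP[-> ->] /=; rewrite Bx; apply/allP => y yp; apply: sub; rewrite inE yp orbT.
  - by rewrite 2!inE mem_cat ux !orbT.
  - by rewrite !inE eqxx orbT.
case/splitPr: xq ucq uq conclude {Cq memq Bq dis} => p1 p2 ucq uq conclude.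
have [/(conclude _ _ ucq)|ux] := boolP (u \in x :: p2); first exact.
have up1 : u \in p1 by move: uq; rewrite mem_cat (negPf ux) orbF.
(* Here [u] lies on the arc that would be dropped, so the cycle is read backwards, which puts this
   arc after [x]. *)
apply: (conclude (rev p2) (rev p1)); last by rewrite inE mem_rev up1 orbT.
- have : ucycle e (rev (w :: p1 ++ x :: p2)).
    rewrite /ucycle rev_uniq rev_cycle; case/andP: ucq => c ->; rewrite andbT.
    by under eq_cycle => a b do rewrite e_sym.
  rewrite rev_cons rev_cat rev_cons -rot1_cons /ucycle rot_cycle rot_uniq.
  by rewrite cat_rcons.
- move=> y; rewrite !inE !mem_cat !inE !mem_rev.
  by case: (y == w); case: (y == x); case: (y \in p1); case: (y \in p2).
Qed.

(* Whitney: the property of being on a common cycle with [u] propagates along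
   a path from [u] to [v]. *)
Lemma cocyclic_nonseparable (B : pred T) u v z :
  nonseparable B -> B u -> B v -> B z -> u != v -> z != u -> z != v ->
  cocyclic B u v.
Proof.
move=> nsB Bu Bv Bz uv zu zv.
have [uz vz] : u != z /\ v != z by rewrite ![_ == z]eq_sym.
(* The path avoids [z], which thus remains a third node when the first edge is handled by
   [cocyclic_edge]. *)
have /connectP[p0 rp0 lp0] := nsB z u v Bu Bv uz vz.
case/shortenP: rp0 lp0 => p + + _.
elim/last_ind: p v {Bv vz zv p0} uv => [|p b IH] v uv; first by move=> _ _ vu; rewrite vu eqxx in uv.
rewrite rcons_path last_rcons -rcons_cons rcons_uniq => /andP[rp rb] /andP[bp up] vb.
case/and3P: rb => eb /andP[_ Bl] /andP[bz Bb]; rewrite {v}vb in uv *.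
have [lu|lu] := eqVneq u (last u p).
  by rewrite -lu in eb; apply: (@cocyclic_edge B u b z) => //; rewrite eq_sym.
exact: cocyclic_step nsB (IH _ lu rp up erefl) eb Bb lu.
Qed.
End CyclesThroughTwoNodes.

(** * Blocks from a depth-first search tree *)

Section DepthFirstTree.
Variables (T : finType) (e : rel T).
Hypotheses (e_sym : symmetric e) (e_irr : irreflexive e).
Variables (x : T) (num : T -> nat) (par : T -> T) (up : T -> seq T).

(** [num] is any injective numbering that increases away from the root, and [up v] is the tree path
    from [v] to [x], both ends included. Depth-first search enters only through [up_adj]: every edge
    joins an ancestor to a descendant. *)
Record dfs_tree : Prop := DfsTree {
  num_inj : injective num;
  num_par : forall v, v != x -> num (par v) < num v;
  par_adj : forall v, v != x -> e (par v) v;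
  up_rec : forall v, up v = v :: (if v == x then [::] else up (par v));
  up_adj : forall u v, e u v -> (u \in up v) || (v \in up u) }.

Variable low : T -> nat.

Definition relevant v w := (w != x) && (w != par v).
(* What the edge [v w] contributes to the lowpoint of [v]. *)
Definition via v w := if par w == v then low w else num w.

(* [low] need not be given as a minimum over subtrees: these local conditions
   determine it. *)
Record low_spec : Prop := LowSpec {
  low_num : forall v, v != x -> low v <= num v;
  low_via : forall v w, v != x -> e v w -> relevant v w -> low v <= via v w;
  low_att : forall v, v != x ->
    low v = num v \/ exists w, [/\ e v w, relevant v w & low v = via v w] }.

Variable head : T -> T.

Definition head_spec :=
  forall v, v != x -> head v = if low v < num (par v) then head (par v) else v.

(** [head v] names the block of the edge from [v] to its parent. The top [par h] has to be added
    separately, as its own parent edge lies elsewhere. *)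
Definition in_block h v := (v != x) && (head v == h) || (v == par h).

(** Since [head h = h] excludes [low h < num (par h)], the last test says that some edge from below
    [h] returns exactly to [par h]. *)
Definition cyclic_block h := [&& h != x, head h == h & low h <= num (par h)].

Hypotheses (tree : dfs_tree) (lows : low_spec) (heads : head_spec).

Lemma tree_ind (P : T -> Prop) :
  P x -> (forall v, v != x -> P (par v) -> P v) -> forall v, P v.
Proof.
move=> Px Ppar v; have [k] := ubnP (num v); elim: k v => // k IH v kv.
have [->//|vx] := eqVneq v x; apply: Ppar => //; apply: IH.
by apply: leq_trans (num_par tree vx) _.
Qed.

Lemma mem_up u v : (u \in up v) = (u == v) || (v != x) && (u \in up (par v)).
Proof. by rewrite (up_rec tree v) inE; case: (v == x). Qed.

Lemma up_refl v : v \in up v.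
Proof. by rewrite mem_up eqxx. Qed.

Lemma up_par v : v != x -> par v \in up v.
Proof. by move=> vx; rewrite mem_up vx up_refl orbT. Qed.

Lemma up_trans v u w : u \in up v -> v \in up w -> u \in up w.
Proof.
move=> uv; elim/tree_ind: w => [|w wx IH]; rewrite [v \in _]mem_up.
  by rewrite eqxx /= orbF => /eqP <-.
by rewrite wx => /orP[/eqP <- //|/IH]; rewrite [u \in up w]mem_up wx orbC => ->.
Qed.

Lemma up_num u v : u \in up v -> num u <= num v.
Proof.
elim/tree_ind: v => [|v vx IH]; rewrite mem_up.
  by rewrite eqxx orbF => /eqP ->.
by have := num_par tree vx; rewrite vx => + /orP[/eqP -> //|/IH]; lia.
Qed.

Lemma up_proper u v : u \in up v -> u != v -> v != x /\ u \in up (par v).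
Proof. by rewrite mem_up => /orP[->//|/andP[]]. Qed.

Lemma up_num_lt u v : u \in up v -> u != v -> num u < num v.
Proof.
move=> uv ne; have [vx /up_num] := up_proper uv ne.
by have := num_par tree vx; lia.
Qed.

Lemma up_num_ge u v : u \in up v -> num v <= num u -> u = v.
Proof. by move=> uv; have [//|/(up_num_lt uv)] := eqVneq u v; lia. Qed.

Lemma up_comparable u v w :
  u \in up w -> v \in up w -> num u <= num v -> u \in up v.
Proof.
elim/tree_ind: w => [|w wx IH] + + le.
  by rewrite mem_up [v \in _]mem_up eqxx !orbF => /eqP -> /eqP ->; apply: up_refl.
rewrite mem_up [v \in _]mem_up wx => /orP[/eqP uE|uw] /orP[/eqP vE|vw].
- by rewrite uE vE up_refl.
- by have := num_par tree wx; have := up_num vw; rewrite -uE; lia.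
- by rewrite vE mem_up wx uw orbT.
- exact: IH.
Qed.

Lemma up_root v : x \in up v.
Proof. by elim/tree_ind: v => [|v vx IH]; rewrite mem_up ?eqxx // vx IH orbT. Qed.

Lemma up_root_neq u v : u \in up v -> u != x -> v != x.
Proof. by move=> + ux; apply: contraTneq => ->; rewrite mem_up eqxx orbF. Qed.

Lemma num_root v : v != x -> num x < num v.
Proof. by move=> vx; apply: up_num_lt (up_root v) _; rewrite eq_sym. Qed.

Lemma low_mono v u : v != x -> v \in up u -> low v <= low u.
Proof.
move=> vx; elim/tree_ind: u => [|u ux IH] vu.
  by have := up_root_neq vu vx; rewrite eqxx.
have [->//|vneu] := eqVneq v u.
have [_ vpu] := up_proper vu vneu; apply: leq_trans (IH vpu) _.
have px : par u != x by apply: up_root_neq vpu vx.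
have rel : relevant (par u) u.
  rewrite /relevant ux /=; apply/eqP => uE.
  by have := num_par tree px; have := num_par tree ux; rewrite -uE; lia.
by have := low_via lows px (par_adj tree ux) rel; rewrite /via eqxx.
Qed.

Lemma low_le v u b :
  v != x -> v \in up u -> e u b -> relevant u b -> par b != u -> low v <= num b.
Proof.
move=> vx vu eub rel pb; apply: leq_trans (low_mono vx vu) _.
by have := low_via lows (up_root_neq vu vx) eub rel; rewrite /via (negPf pb).
Qed.

(** Unfolding [low_att] through children ends because numbers increase downwards and have a maximum;
    what remains is the actual edge that realises the lowpoint. *)
Lemma low_witness v : v != x -> low v = num v \/
  exists u b, [/\ v \in up u, e u b, relevant u b, par b != u & low v = num b].
Proof.
have [k] := ubnP ((\max_w num w) - num v); elim: k v => // k IH v lek vx.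
have [|[w [evw rel +]]] := low_att lows vx; first by left.
have le_max a : num a <= \max_w num w by exact: leq_bigmax.
rewrite /via; case: eqP => [pw|/eqP pw] lE; last first.
  by right; exists v, w; split; rewrite ?up_refl.
have wx : w != x by have /andP[] := rel.
have lt : num v < num w by rewrite -pw num_par.
have [|lw|[u [b [wu eub rub pb lw]]]] := IH w _ wx.
- by have := le_max w; lia.
- by have := low_num lows vx; rewrite lE lw; lia.
by right; exists u, b; rewrite lE lw; split=> //; apply: up_trans wu; rewrite -pw up_par.
Qed.

(** Edges to [x] do not count, so every lowpoint stays above the root; in particular no child of [x]
    heads a cyclic block. *)
Lemma low_root v : v != x -> num x < low v.
Proof.
move=> vx; have [->|[u [b [_ _ /andP[bx _] _ ->]]]] := low_witness vx; exact: num_root.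
Qed.

Lemma low_above v : v != x -> low v < num v ->
  exists u b, [/\ v \in up u, e u b, relevant u b, par b != u &
    low v = num b /\ b \in up (par v)].
Proof.
move=> vx lt; have [lE|[u [b [vu eub rel pb lE]]]] := low_witness vx.
  by rewrite lE ltnn in lt.
exists u, b; split=> //; split=> //; rewrite lE in lt.
have bv : b \in up v.
  have [ub|bu] := orP (up_adj tree eub); first by have := up_num vu; have := up_num ub; lia.
  by apply: up_comparable bu vu _; lia.
by case: (up_proper bv) => //; apply: contraTneq lt => ->; rewrite ltnn.
Qed.

Lemma head_up v : v != x -> head v \in up v.
Proof.
elim/tree_ind: v => [|v vx IH]; rewrite ?eqxx // => _.
rewrite heads //; case: ifP => [lt|_]; last exact: up_refl.
have px : par v != x.
  by apply: contraTneq lt => ->; rewrite -leqNgt ltnW ?low_root.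
by apply: up_trans (IH px) (up_par vx).
Qed.

(* An edge from below [q] to a proper ancestor of [v] bypasses the parents of
   all nodes between [v] and [q]. *)
Lemma head_bypassed v u b q : v != x -> e u b -> relevant u b -> par b != u ->
  num b < num v -> v \in up q -> q \in up u -> head q = head v.
Proof.
move=> vx eub rel pb ltb; elim/tree_ind: q => [|q qx IH] vq qu.
  by have := up_root_neq vq vx; rewrite eqxx.
have [->//|vneq] := eqVneq v q.
have [_ vpq] := up_proper vq vneq.
rewrite heads // -(IH vpq (up_trans (up_par qx) qu)).
have := low_le qx qu eub rel pb; have := up_num vpq; case: ltnP => //; lia.
Qed.

(** * A cyclic block is nonseparable *)

Section Block.
Variable h : T.
Hypothesis cyc_h : cyclic_block h.
Local Notation t := (par h).

Let hx : h != x. Proof. by case/and3P: cyc_h. Qed.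
Let hh : head h = h. Proof. by case/and3P: cyc_h => _ /eqP. Qed.
Let low_h : low h = num t.
Proof.
apply/eqP; rewrite eqn_leq; case/and3P: cyc_h => _ _ -> /=.
move: hh; rewrite heads //; case: ltnP => // lt hE.
have px : par h != x by apply: contraTneq lt => ->; rewrite -leqNgt ltnW ?low_root.
by have := up_num (head_up px); rewrite hE; have := num_par tree hx; lia.
Qed.
Let th : num t < num h. Proof. exact: num_par. Qed.
Let tx : t != x.
Proof. by apply: contraTneq (low_root hx) => tE; rewrite low_h tE ltnn. Qed.

Lemma in_block_root : ~~ in_block h x.
Proof. by rewrite /in_block eqxx /= eq_sym tx. Qed.

Lemma in_block_up v : in_block h v -> v != t -> h \in up v.
Proof. by case/orP => [/andP[vx /eqP <-]|/eqP-> /eqP//] _; apply: head_up. Qed.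

Lemma in_block_par v : in_block h v -> v != t -> in_block h (par v).
Proof.
move=> Bv vt; have hv := in_block_up Bv vt.
have [->|hneq] := eqVneq v h; first by rewrite /in_block eqxx orbT.
have [vx hpv] := up_proper hv ltac:(by rewrite eq_sym).
case/orP: Bv => [/andP[_ /eqP]|/eqP vE]; last by rewrite vE eqxx in vt.
rewrite heads // /in_block (up_root_neq hpv hx); case: ifP => [_ ->|_ /eqP]; rewrite ?eqxx //.
by rewrite (negPf hneq).
Qed.

Lemma in_block_path v a : in_block h v -> v != t -> a \in up v -> t \in up a -> in_block h a.
Proof.
elim/tree_ind: v => [|v vx IH] Bv vt; first by rewrite (negPf in_block_root) in Bv.
rewrite mem_up vx => /orP[/eqP -> //|apv] ta.
have Bp := in_block_par Bv vt.
have [pt|/(IH Bp)] := eqVneq (par v) t; last exact.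
rewrite pt in apv; rewrite (up_num_ge apv) ?(up_num ta) //.
by rewrite /in_block eqxx orbT.
Qed.

(** As [low h = num t], some edge returns from below [h] to [t]. Its lower end is not [h], whose
    parent edge does not count, and it has head [h] by [head_bypassed]. *)
Lemma in_block_third : exists u, [/\ in_block h u, u != h & u != t].
Proof.
have [|u [b [hu eub rel pb [lE _]]]] := low_above hx; first by rewrite low_h.
have bt : b = t by apply: (num_inj tree); rewrite -lE.
have uh : u != h.
  by apply: contraTneq rel => ->; rewrite /relevant bt eqxx andbF.
have ltb : num b < num h by rewrite bt.
exists u; split=> //; last by apply: contraTneq (up_num hu) => ->; rewrite -ltnNge.
rewrite /in_block (up_root_neq hu hx).
by rewrite (head_bypassed hx eub rel pb ltb hu (up_refl u)) hh eqxx.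
Qed.
Let connect_up w a : in_block h a -> a != w -> a != t -> par a != w ->
  connect (within e (without (in_block h) w)) a (par a).
Proof.
move=> Ba aw at_ paw; apply: connect1; rewrite /within /without aw Ba paw in_block_par // !andbT.
by rewrite e_sym par_adj //; apply: contraNneq in_block_root => <-.
Qed.

Lemma connect_block_head a : in_block h a -> a != t ->
  connect (within e (without (in_block h) t)) a h.
Proof.
elim/tree_ind: a => [|a ax IH] Ba at_; first by rewrite (negPf in_block_root) in Ba.
have [->|ha] := eqVneq h a; first exact: connect0.
have [_ hpa] := up_proper (in_block_up Ba at_) ha.
have pat : par a != t by apply: contraTneq (up_num hpa) => ->; rewrite -ltnNge.
exact: connect_trans (connect_up Ba at_ at_ pat) (IH (in_block_par Ba at_) pat).
Qed.

(** Climb from [a] towards [t]. If [w] blocks the way as the parent of [a], then [a] is not its own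
    head, so an edge from below [a] returns to a proper ancestor [b] of [w]: go down from [a] to the
    lower end of this edge, jump to [b], and continue by induction on the number. The nodes visited
    below [a] stay in the block by [head_bypassed]. *)
Lemma connect_block_top w a : w != t -> in_block h a -> a != w ->
  connect (within e (without (in_block h) w)) a t.
Proof.
move=> wt; have [k] := ubnP (num a); elim: k a => // k IH a ak Ba aw.
have [->|at_] := eqVneq a t; first exact: connect0.
have ax : a != x by apply: contraNneq in_block_root => <-.
have Bpa := in_block_par Ba at_; have npa := num_par tree ax.
have [paw|paw] := eqVneq (par a) w; last first.
  by apply: connect_trans (connect_up Ba aw at_ paw) (IH _ _ Bpa paw); lia.
have hw : h \in up w by rewrite -paw (in_block_up Bpa) // paw.
have wx : w != x by rewrite (up_root_neq hw).
have [ha ah] : h \in up a /\ h != a.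
  split; first exact: in_block_up.
  by apply: contraTneq hw => ->; apply/negP => /up_num; rewrite -paw leqNgt npa.
have lowa : low a < num w.
  have := Ba; rewrite /in_block ax (negPf at_) orbF heads // paw; case: ltnP => //.
  by rewrite eq_sym (negPf ah).
have nwa : num w < num a by rewrite -paw.
have [u [b [au eub rel pb [lE bw]]]] := low_above ax (ltn_trans lowa nwa).
have nb : num b < num w by rewrite -lE.
have bB : in_block h b.
  rewrite paw in bw; apply: (in_block_path _ wt bw); first by rewrite -paw.
  apply: up_comparable (up_trans (up_par hx) hw) bw _.
  by rewrite -low_h -lE (low_mono hx).
have bneq : b != w by apply: contraTneq nb => ->; rewrite ltnn.
have nba := ltn_trans nb nwa.
have cb : connect (within e (without (in_block h) w)) b t by apply: IH; rewrite // (leq_trans nba).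
have Bq q : a \in up q -> q \in up u -> in_block h q /\ q != w.
  move=> aq qu; have qx := up_root_neq aq ax.
  split; last by apply: contraTneq (up_num aq) => ->; rewrite -paw -ltnNge.
  rewrite /in_block qx (head_bypassed ax eub rel pb nba aq qu).
  by move: Ba; rewrite /in_block ax (negPf at_) orbF => ->.
have {cb} cu : connect (within e (without (in_block h) w)) u t.
  apply: connect_trans (connect1 _) cb.
  have [Bu uw] := Bq u au (up_refl u).
  by rewrite /within /without eub Bu uw bB bneq.
suff : forall q, a \in up q -> q \in up u ->
    connect (within e (without (in_block h) w)) a q.
  by move=> /(_ u au (up_refl u)) aq; apply: connect_trans aq cu.
elim/tree_ind => [|q qx IHq] aq qu; first by have := up_root_neq aq ax; rewrite eqxx.
have [->|aneq] := eqVneq a q; first exact: connect0.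
have [_ apq] := up_proper aq aneq; have pqu := up_trans (up_par qx) qu.
apply: connect_trans (IHq apq pqu) (connect1 _).
have [[B1 n1] [B2 n2]] := (Bq _ aq qu, Bq _ apq pqu).
by rewrite /within /without (par_adj tree) // B1 n1 B2 n2.
Qed.

Lemma nonseparable_block : nonseparable e (in_block h).
Proof.
have csym P : connect_sym (within e P) by apply: sym_connect_sym; apply: within_sym.
move=> w a b Ba Bb aw bw; have [wt|wt] := eqVneq w t.
  rewrite wt in aw bw *.
  by apply: connect_trans (connect_block_head Ba aw) _; rewrite csym connect_block_head.
by apply: connect_trans (connect_block_top wt Ba aw) _; rewrite csym connect_block_top.
Qed.

Lemma block_cocyclic y z : in_block h y -> in_block h z -> y != z ->
  cocyclic e (predC1 x) y z.
Proof.
(* A third node of the block is needed for the common cycle: one of [h], [par h] and the node from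
   [in_block_third] differs from both [y] and [z]. *)
move=> By Bz yz; have [w [Bw wy wz]] : exists w, [/\ in_block h w, w != y & w != z].
  have [u [Bu uh ut]] := in_block_third.
  have [Bh Bt] : in_block h h /\ in_block h t by rewrite /in_block hx hh !eqxx orbT.
  have ht : h != t by apply: contraTneq th => <-; rewrite ltnn.
  have [hy|hy] := eqVneq h y; last have [hz|hz] := eqVneq h z; last by exists h.
    have [tz|tz] := eqVneq t z; first by exists u; rewrite -hy -tz.
    by exists t; rewrite -hy eq_sym.
  have [ty|ty] := eqVneq t y; first by exists u; rewrite -hz -ty.
  by exists t; rewrite -hz [t == h]eq_sym.
have [C [uC sC BC yC zC]] := cocyclic_nonseparable e_sym e_irr nonseparable_block By Bz Bw yz wy wz.
exists C; split=> //; apply: sub_all BC => v Bv /=.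
by apply: contraNneq in_block_root => <-.
Qed.
End Block.

(** * Every cycle that avoids the root lies in a cyclic block *)

Lemma path_exit (P : pred T) a p : path e a p -> P a -> ~~ P (last a p) ->
  exists c d, [/\ e c d, P c, ~~ P d & d \in p].
Proof.
elim: p a => [|b p IH] a /=; first by move=> _ ->.
case/andP=> eab bp Pa lp; have [Pb|nPb] := boolP (P b).
  by have [c [d [ecd Pc Pd dp]]] := IH b bp Pb lp; exists c, d; rewrite inE dp orbT.
by exists a, b; rewrite mem_head.
Qed.

(** An edge can leave the subtree of [t] only towards a proper ancestor of [t], which has a smaller
    number. *)
Lemma path_below t a p : path e a p -> t \in up a ->
  (forall v, v \in p -> num t <= num v) -> forall v, v \in p -> t \in up v.
Proof.
elim: p a => // b p IH a /= /andP[eab bp] ta tp v.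
have tb : t \in up b.
  have [ab|ba] := orP (up_adj tree eab); first exact: up_trans ta ab.
  by apply: up_comparable ta ba _; rewrite tp ?mem_head.
rewrite inE => /orP[/eqP -> //|]; apply: IH bp tb _ _ => w wp.
by rewrite tp // inE wp orbT.
Qed.

(** An edge leaving the subtree of [h] ends in a proper ancestor of [h]; within the subtree of
    [par h] the only one is [par h] itself, which the path avoids. *)
Lemma path_child h a p : h != x -> path e a p -> h \in up a ->
  (forall v, v \in p -> par h \in up v /\ v != par h) ->
  forall v, v \in p -> h \in up v.
Proof.
move=> hx; elim: p a => // b p IH a /= /andP[eab bp] ha tp v.
have hb : h \in up b.
  have [ab|ba] := orP (up_adj tree eab); first exact: up_trans ha ab.
  case: (leqP (num h) (num b)) => [|/ltnW] hb; first exact: up_comparable ha ba hb.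
  have bh := up_comparable ba ha hb.
  have [->|bneq] := eqVneq b h; first exact: up_refl.
  have [_ bph] := up_proper bh bneq.
  have [tb /eqP[]] := tp b (mem_head _ _).
  exact: up_num_ge bph (up_num tb).
rewrite inE => /orP[/eqP -> //|]; apply: IH bp hb _ _ => w wp.
by apply: tp; rewrite inE wp orbT.
Qed.

Lemma child_towards t v : t \in up v -> v != t ->
  exists h, [/\ h != x, par h = t & h \in up v].
Proof.
elim/tree_ind: v => [|v vx IH]; first by rewrite mem_up eqxx orbF eq_sym => ->.
move=> tv vt; have [_ tpv] := up_proper tv ltac:(by rewrite eq_sym).
have [pt|/(IH tpv)[h [hx ph hpv]]] := eqVneq (par v) t.
  by exists v; rewrite up_refl.
by exists h; split=> //; apply: up_trans hpv (up_par vx).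
Qed.

(** The edge [c d] runs from the subtree of [u] to a proper ancestor of [par u], and it is one of
    the edges that bound [low u]. *)
Lemma low_exit u c d : u != x -> d != x -> e c d -> u \in up c -> u \notin up d ->
  d != par u -> low u < num (par u).
Proof.
move=> ux dx ecd uc ud dpu.
have [cd|dc] := orP (up_adj tree ecd); first by rewrite (up_trans uc cd) in ud.
have lt : num d < num u.
  by rewrite ltnNge; apply: contra ud; apply: up_comparable uc dc.
have du := up_comparable dc uc (ltnW lt).
have dneq : d != u by apply: contraTneq lt => ->; rewrite ltnn.
have [_ dpar] := up_proper du dneq.
apply: leq_ltn_trans (up_num_lt dpar dpu); apply: (low_le ux uc ecd).
  rewrite /relevant dx /=; apply/eqP => dE.
  have [uE|uneq] := eqVneq u c; first by rewrite uE dE eqxx in dpu.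
  by have [_] := up_proper uc uneq; rewrite -dE (negPf ud).
apply: contraTneq (num_par tree dx) => ->.
by rewrite -leqNgt; apply: leq_trans (ltnW lt) (up_num uc).
Qed.

(** If [head v] differs from [v], then a child of [head v] was merged with it. The edge responsible
    for this lands strictly above [head v], hence at its parent or higher. *)
Lemma head_cyclic v : v != x -> [/\ head v != x, head (head v) = head v &
  head v != v -> low (head v) <= num (par (head v))].
Proof.
elim/tree_ind: v => [|v vx IH]; rewrite ?eqxx // => _.
have hv := heads vx; move: hv; case: ifP => [lt|nlt] hv; last first.
  by rewrite !hv eqxx; split; rewrite // hv.
have px : par v != x.
  by apply: contraTneq lt => ->; rewrite -leqNgt ltnW ?low_root.
rewrite hv; have [IH1 IH2 IH3] := IH px; split=> // _.
have [hp|/IH3//] := eqVneq (head (par v)) (par v); rewrite hp.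
have [u [b [_ _ _ _ [lE bv]]]] := low_above vx (ltn_trans lt (num_par tree vx)).
have bneq : b != par v by apply: contraTneq lt => <-; rewrite lE ltnn.
have [_ /up_num] := up_proper bv bneq; apply: leq_trans.
by rewrite -lE low_mono ?up_par.
Qed.

Lemma head_const h v : h != x -> h \in up v ->
  (forall u, u \in up v -> h \in up u -> u != h -> low u < num (par u)) ->
  head v = head h.
Proof.
move=> hx; elim/tree_ind: v => [|v vx IH] hv lt.
  by have := up_root_neq hv hx; rewrite eqxx.
have [->//|vh] := eqVneq v h.
have [_ hpv] := up_proper hv ltac:(by rewrite eq_sym).
rewrite heads // lt ?up_refl // IH // => u upv.
by apply: lt; apply: up_trans upv (up_par vx).
Qed.

(** The node [t] of least number on the cycle has the whole cycle below it, and the rest of the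
    cycle, a path avoiding [t], stays below one child [h] of [t]. The main point is that all these
    nodes have the same head as [h]. *)
Lemma cocyclic_block y z : cocyclic e (predC1 x) y z ->
  exists h, [/\ cyclic_block h, in_block h y & in_block h z].
Proof.
case=> C0 [uC0 sC0 xC0 yC0 zC0].
have [t [tC0 tmin]] : exists t, t \in C0 /\ forall v, v \in C0 -> num t <= num v.
  by case: (arg_minnP num yC0) => t tC0 tmin; exists t.
have [i p Cp] := rot_to tC0.
have memp v : (v \in C0) = (v \in t :: p) by rewrite -Cp mem_rot.
have /andP[cp up_] : ucycle e (t :: p) by rewrite -Cp /ucycle rot_cycle rot_uniq.
have sp : 1 < size p by move: sC0; rewrite -(size_rot i) Cp.
have xp v : v \in t :: p -> v != x by rewrite -memp => /(allP xC0).
have {}tmin v : v \in t :: p -> num t <= num v by rewrite -memp; apply: tmin.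
move: yC0 zC0; rewrite !memp => yC zC {memp tC0 Cp C0 uC0 sC0 xC0}.
have tx : t != x by rewrite xp ?mem_head.
have /andP[tp _] := up_.
have ptp : path e t p by move: cp; rewrite /= rcons_path => /andP[].
have below : forall v, v \in p -> t \in up v.
  by apply: path_below ptp (up_refl t) _ => v vp; rewrite tmin // inE vp orbT.
have neqt v : v \in p -> v != t by apply: contraTneq => ->.
case: p sp cp up_ tp ptp tmin xp yC zC below neqt => // v1 p'.
set p := v1 :: p' => sp cp up_ tp ptp tmin xp yC zC below neqt.
have v1p : v1 \in p by rewrite mem_head.
have [h [hx ph hv1]] := child_towards (below _ v1p) (neqt _ v1p).
have hp : forall v, v \in p -> h \in up v.
  move=> v; rewrite inE => /orP[/eqP -> //|].
  apply: (path_child hx _ hv1); first by case/andP: ptp.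
  by move=> w wp; rewrite ph below ?neqt // inE wp orbT.
have nth_ : num t < num h by rewrite -ph num_par.
have px v : v \in p -> v != x by move=> vp; rewrite xp // inE vp orbT.
(* The two neighbours of [t] on the cycle are distinct; the edge from one that is not [h] returns to
   [t] from below [h]. *)
have low_h : low h <= num t.
  have low_nbr v : v \in p -> e v t -> v != h -> low h <= num t.
    move=> vp evt vh; apply: (low_le hx (hp v vp) evt).
      rewrite /relevant tx /=; apply: contraTneq nth_ => tE.
      have [_ /up_num] := up_proper (hp v vp) ltac:(by rewrite eq_sym).
      by rewrite -tE -leqNgt.
    apply: contraTneq (num_par tree tx) => ->; rewrite -leqNgt.
    by rewrite ltnW // (leq_trans nth_) ?up_num ?hp.
  have [v1h|] := eqVneq v1 h; last first.
    by apply: low_nbr => //; rewrite e_sym; case/andP: ptp.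
  apply: (low_nbr (last v1 p')); first exact: mem_last.
    by move: cp; rewrite /= rcons_path => /and3P[].
  rewrite -v1h; move: up_ sp; rewrite /p; case: (p') => // v2 p'' /and3P[_ v1p'' _] _ /=.
  by apply: contraNneq v1p'' => <-; apply: mem_last.
(* Both arcs of the cycle from [v] to [t] leave the subtree of [u]. They cannot both leave towards
   [par u]: beyond [v] the arcs share only [t], and [par u] is not [t] because it is still below
   [h]. So [low_exit] applies to one of them. *)
have bypass v u : v \in p -> u \in up v -> h \in up u -> u != h -> low u < num (par u).
  move=> vp uv hu uh.
  have ux := up_root_neq hu hx.
  have [_ hpu] := up_proper hu ltac:(by rewrite eq_sym).
  have ut : u \notin up t.
    by apply/negP => /up_num; rewrite leqNgt (leq_trans nth_) ?up_num.
  case/splitPr: vp cp up_ xp => p1 p2 cp up_ xp.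
  have [p1v p2t] : path e t (rcons p1 v) /\ path e v (rcons p2 t).
    by move: cp; rewrite /= -cat_rcons rcons_cat cat_path last_rcons => /andP[].
  have {}p1v : path e v (rcons (rev p1) t).
    rewrite -rev_cons -(belast_rcons t p1 v) -[in path e v](last_rcons t p1 v) rev_path.
    by under eq_path => a b do rewrite e_sym.
  have [c [d [ecd uc ud dp]]] :=
    path_exit (P := fun a => u \in up a) p2t uv ltac:(by rewrite last_rcons).
  have [c' [d' [ecd' uc' ud' dp']]] :=
    path_exit (P := fun a => u \in up a) p1v uv ltac:(by rewrite last_rcons).
  have dx : d != x.
    apply: xp; move: dp; rewrite mem_rcons !inE mem_cat inE.
    by case/orP => ->; rewrite ?orbT.
  have dx' : d' != x.
    apply: xp; move: dp'; rewrite mem_rcons !inE mem_cat inE mem_rev.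
    by case/orP => ->; rewrite ?orbT.
  have [dpu|/(low_exit ux dx ecd uc ud)//] := eqVneq d (par u).
  have [dpu'|/(low_exit ux dx' ecd' uc' ud')//] := eqVneq d' (par u).
  suff pt : par u = t by have := up_num hpu; rewrite pt leqNgt nth_.
  apply/eqP; apply: contraTT up_ => pt; move: dp dp'.
  rewrite dpu dpu' !mem_rcons !inE (negPf pt) mem_rev /= => pu2 pu1.
  apply/negP => /andP[_]; rewrite cat_uniq /= => /and3P[_ /norP[_ /hasPn/(_ _ pu2)]].
  by rewrite /= pu1.
have headp v : v \in p -> head v = head h.
  by move=> vp; apply: head_const (hp v vp) _ => // u uv; apply: bypass uv.
have [h0x hh0 lh0] := head_cyclic hx.
have hE := heads hx; rewrite ph in hE.
(* Either [h] is merged with the edge above it and shares the head of [t], or [h] is its own head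
   and [t] is the top. *)
have Bt : in_block (head h) t.
  rewrite /in_block tx; move: hE; case: ifP => [_ ->|_ ->]; first by rewrite eqxx.
  by rewrite ph eqxx orbT.
have Bp v : v \in t :: p -> in_block (head h) v.
  rewrite inE => /orP[/eqP -> //|vp].
  by rewrite /in_block px // headp // eqxx.
exists (head h); split; rewrite ?Bp //.
rewrite /cyclic_block h0x hh0 eqxx /=.
by have [->|//] := eqVneq (head h) h; rewrite ph.
Qed.

Theorem cocyclicP y z : y != z -> cocyclic e (predC1 x) y z <->
  exists h, [/\ cyclic_block h, in_block h y & in_block h z].
Proof.
move=> yz; split; first exact: cocyclic_block.
by case=> h [ch By Bz]; apply: block_cocyclic By Bz yz.
Qed.
End DepthFirstTree.

(** * Running time of programs *)

Lemma upd_same T (f : nat -> T) i v : upd f i v i = v.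
Proof. by rewrite /upd eqxx. Qed.

Definition spec (p : prog) (s : memory) (Q : nat -> memory -> Prop) :=
  exists t s', run p s t s' /\ Q t s'.

Fixpoint wvar (p : prog) (x : nat) : bool :=
  match p with
  | Assign y _ => x == y
  | Seq p q | If _ p q => wvar p x || wvar q x
  | While _ p => wvar p x
  | _ => false
  end.

Fixpoint warr (p : prog) (a : nat) : bool :=
  match p with
  | Put b _ _ => a == b
  | Seq p q | If _ p q => warr p a || warr q a
  | While _ p => warr p a
  | _ => false
  end.

(** A frame condition: the cells written are over-approximated from the program text, so that its
    side conditions are settled by computation. *)
Definition same (p : prog) (s s' : memory) :=
  (forall x, ~~ wvar p x -> vars s' x = vars s x) /\
  (forall a, ~~ warr p a -> arrs s' a = arrs s a).

Lemma run_same p s t s' : run p s t s' -> same p s s'.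
Proof.
rewrite /same; elim=> {p s t s'} //=.
- by move=> x e s; split=> // y; rewrite /upd; case: eqP.
- by move=> a i e s; split=> // b; rewrite /upd; case: eqP.
- move=> p q s t s1 u s2 _ [IHv IHa] _ [JHv JHa].
  by split=> [x|a] /norP[pn qn]; rewrite (JHv, JHa) // (IHv, IHa).
- by move=> b p q s t s1 _ _ [IHv IHa]; split=> [x|a] /norP[pn qn]; rewrite (IHv, IHa).
- by move=> b p q s t s1 _ _ [IHv IHa]; split=> [x|a] /norP[pn qn]; rewrite (IHv, IHa).
- move=> b p s t s1 u s2 _ _ [IHv IHa] _ [JHv JHa].
  by split=> [x|a] pn; rewrite (JHv, JHa) // (IHv, IHa).
Qed.

Lemma spec_weaken p s (Q R : nat -> memory -> Prop) :
  spec p s Q -> (forall t s', Q t s' -> R t s') -> spec p s R.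
Proof. by case=> t [s' [r q]] QR; exists t, s'; split; last exact: QR. Qed.

Lemma spec_seq p q s (Q R : nat -> memory -> Prop) :
  spec p s Q -> (forall t s1, same p s s1 -> Q t s1 -> spec q s1 (fun u s2 => R (t + u) s2)) ->
  spec (Seq p q) s R.
Proof.
case=> t [s1 [r1 q1]] /(_ t s1 (run_same r1) q1)[u [s2 [r2 q2]]].
by exists (t + u), s2; split=> //; apply: RunSeq r1 r2.
Qed.

(** The potential is an index of the invariant rather than a function of the memory, because that of
    the search depends on ghost data. Each round pays for the body and its own test; the extra term
    of the bound is the last, failing test. *)
Lemma spec_while_pot b p s (I : nat -> memory -> Prop) m :
  I m s ->
  (forall m1 s1, same p s s1 -> I m1 s1 -> holds s1 b ->
     spec p s1 (fun t s2 => exists2 m2, I m2 s2 & t + (tcost b).+1 + m2 <= m1)) ->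
  spec (While b p) s (fun t s2 =>
    [/\ same p s s2, exists m2, I m2 s2, ~~ holds s2 b & t <= m + (tcost b).+1]).
Proof.
move=> Is step; suff : forall s1, same p s s1 -> I m s1 -> spec (While b p) s1
    (fun t s2 => [/\ same p s s2, exists m2, I m2 s2, ~~ holds s2 b & t <= m + (tcost b).+1]).
  exact.
elim/ltn_ind: m {Is} => m IH s1 sm Is1.
have [hb|nb] := boolP (holds s1 b); last first.
  exists (tcost b).+1, s1; split; first exact: RunWhileF.
  by split=> //; [exists m | rewrite leq_addl].
have [t [s2 [r2 [m2 Is2 le2]]]] := step m s1 sm Is1 hb.
have sm2 : same p s s2.
  have [sv sa] := sm; have [sv2 sa2] := run_same r2.
  by split=> [x|a] pn; rewrite (sv2, sa2) // (sv, sa).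
have [|u [s3 [r3 [sm3 Is3 nb3 le3]]]] := IH m2 _ s2 sm2 Is2; first by lia.
exists (tcost b + t + u).+1, s3; split; first exact: RunWhileT r2 r3.
by split=> //; lia.
Qed.

Lemma spec_while b p s (I : memory -> Prop) (Phi : memory -> nat) :
  I s ->
  (forall s1, same p s s1 -> I s1 -> holds s1 b ->
     spec p s1 (fun t s2 => I s2 /\ t + (tcost b).+1 + Phi s2 <= Phi s1)) ->
  spec (While b p) s
    (fun t s2 => [/\ same p s s2, I s2, ~~ holds s2 b & t <= Phi s + (tcost b).+1]).
Proof.
move=> Is step; pose J m s1 := I s1 /\ Phi s1 = m.
apply: spec_weaken (@spec_while_pot _ _ _ J (Phi s) _ _) _ => //.
- move=> m s1 sm [Is1 <-] hb; apply: spec_weaken (step s1 sm Is1 hb) _.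
  by move=> t s2 [Is2 le2]; exists (Phi s2).
- by move=> t s2 [sm [m [Is2 _]] nb le].
Qed.

(** A calculus for loop-free code: a loop gets [False], and loops are handled by the rules with a
    potential. *)
Fixpoint wp (p : prog) (Q : memory -> Prop) (s : memory) : Prop :=
  match p with
  | Skip => Q s
  | Assign x e => Q (set_var s x (eval s e))
  | Put a i e => Q (set_cell s a (eval s i) (eval s e))
  | Seq p q => wp p (wp q Q) s
  | If b p q => (holds s b -> wp p Q s) /\ (~~ holds s b -> wp q Q s)
  | While _ _ => False
  end.

Fixpoint wcost (p : prog) : nat :=
  match p with
  | Skip => 1
  | Assign _ e => (ecost e).+1
  | Put _ i e => (ecost i + ecost e).+1
  | Seq p q => wcost p + wcost q
  | If b p q => (tcost b + maxn (wcost p) (wcost q)).+1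
  | While _ _ => 0
  end.

Lemma wp_spec p Q s : wp p Q s -> spec p s (fun t s' => t <= wcost p /\ Q s').
Proof.
elim: p Q s => //=.
- by move=> Q s Qs; exists 1, s; do !split=> //; constructor.
- by move=> x e Q s Qs; do 2 eexists; do !split; [constructor | | exact: Qs].
- by move=> a i e Q s Qs; do 2 eexists; do !split; [constructor | | exact: Qs].
- move=> p IHp q IHq Q s /IHp[t [s1 [r1 [le1 /IHq[u [s2 [r2 [le2 Qs2]]]]]]]].
  exists (t + u), s2; split; first exact: RunSeq r1 r2.
  by split=> //; rewrite leq_add.
- move=> b p IHp q IHq Q s [wpp wpq]; have [hb|nb] := boolP (holds s b).
    have [t [s1 [r1 [le1 Qs1]]]] := IHp _ _ (wpp hb).
    exists (tcost b + t).+1, s1; split; first exact: RunIfT.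
    by split=> //; rewrite ltnS leq_add2l leq_max le1.
  have [t [s1 [r1 [le1 Qs1]]]] := IHq _ _ (wpq nb).
  exists (tcost b + t).+1, s1; split; first exact: RunIfF.
  by split=> //; rewrite ltnS leq_add2l leq_max le1 orbT.
Qed.

Lemma spec_while_wp b p s (I : memory -> Prop) (Phi : memory -> nat) :
  I s ->
  (forall s1, same p s s1 -> I s1 -> holds s1 b ->
     wp p (fun s2 => I s2 /\ wcost p + (tcost b).+1 + Phi s2 <= Phi s1) s1) ->
  spec (While b p) s
    (fun t s2 => [/\ same p s s2, I s2, ~~ holds s2 b & t <= Phi s + (tcost b).+1]).
Proof.
move=> Is step; apply: spec_while => // s1 sm Is1 hb.
apply: spec_weaken (wp_spec (step s1 sm Is1 hb)) _ => t s2 [le [Is2 le2]].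
by split=> //; apply: leq_trans le2; rewrite !leq_add2r.
Qed.

(** * Depth-first search *)

(* Names of variables (v...) and arrays (a...). They are notations so that
   updates at two of them reduce. *)
Local Notation vn := 0.
Local Notation vx := 1.
Local Notation vu := 2.
Local Notation vi := 3.
Local Notation vw := 4.
Local Notation vk := 5.
Local Notation vres := 6.
Local Notation vh := 7.
Local Notation vval := 8.
Local Notation vp := 9.
Local Notation aoff := 0.
Local Notation aadj := 1.
Local Notation aptr := 2.
Local Notation apar := 3.
Local Notation anum := 4.
Local Notation aord := 5.
Local Notation alow := 6.
Local Notation ahead := 7.
Local Notation aseen := 8.
Local Notation amark := 9.
Local Notation "p ;; q" := (Seq p q) (at level 100, right associativity).

Definition incr v := Assign v (Succ (Var v)).

(** The number [n] stands for an undiscovered node, discovered ones being numbered below [n]; [aptr]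
    points to the first adjacency cell not yet scanned. *)
Definition init_body :=
  Put aptr (Var vi) (Get aoff (Var vi)) ;;
  Put anum (Var vi) (Var vn) ;;
  Put amark (Var vi) (Const 0) ;;
  incr vi.
Definition init_loop := While (Lt (Var vi) (Var vn)) init_body.

Definition mark_body := Put amark (Get aadj (Var vi)) (Const 1) ;; incr vi.
Definition mark_loop := While (Lt (Var vi) (Get aoff (Succ (Var vx)))) mark_body.

Definition discover :=
  Put apar (Var vw) (Var vu) ;;
  Put anum (Var vw) (Var vk) ;;
  Put aord (Var vk) (Var vw) ;;
  incr vk ;;
  Assign vu (Var vw).
(** No stack is stored: the parent pointers lead back, and the parent of the root is [n], which ends
    the loop. *)
Definition dfs_body :=
  If (Lt (Get aptr (Var vu)) (Get aoff (Succ (Var vu))))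
    (Assign vw (Get aadj (Get aptr (Var vu))) ;;
     Put aptr (Var vu) (Succ (Get aptr (Var vu))) ;;
     If (Eq (Get anum (Var vw)) (Var vn)) discover Skip)
    (Assign vu (Get apar (Var vu))).
Definition dfs_loop := While (Lt (Var vu) (Var vn)) dfs_body.

(* Compressed sparse rows. *)
Record csr (n : nat) (off adj : nat -> nat) (E : rel nat) : Prop := Csr {
  csr_le : forall i, i < n -> off i <= off i.+1;
  csr_adj : forall i k, i < n -> off i <= k < off i.+1 -> E i (adj k);
  csr_ex : forall i j, E i j -> exists2 k, off i <= k < off i.+1 & adj k = j;
  csr_lt : forall i j, E i j -> i < n;
  csr_sym : symmetric E }.

Section Search.
Variables (n : nat) (off adj : nat -> nat) (E : rel nat).
Hypothesis G : csr n off adj E.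

Definition loaded s := [/\ vars s vn = n, arrs s aoff = off & arrs s aadj = adj].

Lemma init_loop_spec s : loaded s -> vars s vi = 0 ->
  spec init_loop s (fun t s' => [/\ same init_body s s', t <= 30 * n + 4 &
    forall i, i < n ->
      [/\ arrs s' aptr i = off i, arrs s' anum i = n & arrs s' amark i = 0]]).
Proof.
move=> [sn soff sadj] si.
pose I s1 := vars s1 vi <= n /\ forall i, i < vars s1 vi ->
      [/\ arrs s1 aptr i = off i, arrs s1 anum i = n & arrs s1 amark i = 0].
(* The body costs 13 and the test 4; 30 per round is a rounded bound. *)
apply: spec_weaken (@spec_while_wp _ _ s I (fun s1 => 30 * (n - vars s1 vi)) _ _) _.
- by rewrite /I si.
- move=> s1 [sv sa] [le1 I1] /=; rewrite (sv vn) // sn => lt1.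
  have off1 : arrs s1 aoff = off by rewrite sa.
  rewrite /I /= /upd /= off1; split; last by lia.
  split=> // i; rewrite ltnS leq_eqVlt; case: eqP => [-> //|_ /= /I1 //].
move=> t s2 [[sv sa] [le2 I2] /= + let_]; rewrite (sv vn) // sn -leqNgt => ge2.
by split=> //; [lia | move=> i lti; apply: I2; lia].
Qed.

Lemma mark_loop_spec s x : loaded s -> x < n -> vars s vx = x -> vars s vi = off x ->
  (forall v, v < n -> arrs s amark v = 0) ->
  spec mark_loop s (fun t s' => [/\ same mark_body s s',
    t <= 30 * (off x.+1 - off x) + 6 &
    forall v, v < n -> arrs s' amark v = E x v]).
Proof.
move=> [sn soff sadj] ltx sx si s0.
pose I s1 := [/\ off x <= vars s1 vi <= off x.+1,
  forall k, off x <= k < vars s1 vi -> arrs s1 amark (adj k) = 1 &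
  forall v, v < n -> arrs s1 amark v = 0 \/ arrs s1 amark v = 1 /\ E x v].
apply: spec_weaken (@spec_while_wp _ _ s I (fun s1 => 30 * (off x.+1 - vars s1 vi)) _ _) _.
- rewrite /I si leqnn (csr_le G) //; split=> // [k|v /s0 ->]; last by left.
  by lia.
- move=> s1 [sv sa] [le1 I1 I2] /=; rewrite (sv vx) // (sa aoff) // sx soff => lt1.
  rewrite /I /= /upd /= (sa aadj) // sadj; split; last by lia.
  split=> [|k|v ltv]; first by lia.
    case: eqP => // ne; rewrite ltnS => /andP[ge]; rewrite leq_eqVlt => /orP[/eqP kE|lt].
      by rewrite kE in ne.
    by rewrite I1 // ge.
  case: eqP => [->|_]; last exact: I2.
  by right; split=> //; apply: (csr_adj G); lia.
move=> t s2 [sm [le2 I1 I2] /= + let_]; have [sv sa] := sm.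
rewrite (sv vx) // (sa aoff) // soff sx -leqNgt => ge2; split=> //; first by lia.
move=> v ltv; have [Exv|nExv] := boolP (E x v).
  by have [k kr <-] := csr_ex G Exv; apply: I1; lia.
by case: (I2 v ltv) => [//|[_]]; rewrite (negPf nExv).
Qed.
(** The adjacency cells still to be scanned. At [off] this is the total length of the lists, which
    enters the final time bound. *)
Definition todo (ptr : nat -> nat) := \sum_(v < n) (off v.+1 - ptr v).

Lemma todo_next ptr u : u < n -> ptr u < off u.+1 ->
  (todo (upd ptr u (ptr u).+1)).+1 = todo ptr.
Proof.
move=> un lt; rewrite /todo (bigD1 (Ordinal un)) //= [RHS](bigD1 (Ordinal un)) //=.
rewrite [in RHS](eq_bigr (fun v : 'I_n => off v.+1 - upd ptr u (ptr u).+1 v)).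
  by rewrite /upd eqxx; lia.
move=> v vu; rewrite /upd; case: eqP => // vE.
by case/negP: vu; apply/eqP/val_inj.
Qed.

Lemma todo_ext f g : (forall v, v < n -> f v = g v) -> todo f = todo g.
Proof. by move=> fg; apply: eq_bigr => v _; rewrite fg. Qed.

Record searched (x : nat) (par num ord : nat -> nat) (up : nat -> seq nat) : Prop :=
  Searched {
    s_num : forall v, v < n -> num v < n /\ ord (num v) = v;
    s_ord : forall k, k < n -> ord k < n /\ num (ord k) = k;
    s_root : num x = 0;
    s_parx : par x = n;
    s_par : forall v, v < n -> v != x ->
      [/\ par v < n, num (par v) < num v & E (par v) v];
    s_up : forall v, v < n -> up v = v :: (if v == x then [::] else up (par v));
    s_adj : forall u v, E u v -> (u \in up v) || (v \in up u) }.

Section DepthFirst.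
Variable x : nat.
Hypothesis xn : x < n.
Hypothesis conn : forall S : pred nat,
  S x -> (forall u v, S u -> E u v -> S v) -> forall v, v < n -> S v.

(* [vis] lists the discovered nodes in order; [up u] is the tree path from the
   current node [u] to the root, i.e. the stack of the search. *)
Record searching (vis : seq nat) (up : nat -> seq nat) (s : memory) : Prop := Searching {
  d_k : vars s vk = size vis;
  d_uniq : uniq vis;
  d_lt : all (fun v => v < n) vis;
  d_x : nth 0 vis 0 = x;
  d_xin : x \in vis;
  d_num : forall v, v < n -> arrs s anum v = if v \in vis then index v vis else n;
  d_ord : forall k, k < size vis -> arrs s aord k = nth 0 vis k;
  d_parx : arrs s apar x = n;
  d_par : forall v, v \in vis -> v != x ->
    [/\ arrs s apar v \in vis, index (arrs s apar v) vis < index v vis &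
        E (arrs s apar v) v];
  d_up : forall v, v \in vis -> up v = v :: (if v == x then [::] else up (arrs s apar v));
  d_up0 : up n = [::];
  d_upvis : forall v w, v \in vis -> w \in up v -> w \in vis;
  d_u : (vars s vu == n) || (vars s vu \in vis);
  d_adj : forall v w, v \in vis -> w \in vis -> E v w -> (v \in up w) || (w \in up v);
  d_ptr : forall v, v < n -> off v <= arrs s aptr v <= off v.+1;
  d_new : forall v, v < n -> v \notin vis -> arrs s aptr v = off v;
  d_seen : forall v k, v \in vis -> off v <= k < arrs s aptr v -> adj k \in vis;
  d_fin : forall v, v \in vis -> v \notin up (vars s vu) ->
    arrs s aptr v = off v.+1 }.

(** Scanning a cell releases 100 and a pop releases 50; a discovery moves a node from undiscovered
    to the stack without changing the sum of the last two terms. Each round thus releases at least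
    50, while body and test cost at most 39. *)
Definition potential (vis : seq nat) (up : nat -> seq nat) (s : memory) :=
  100 * todo (arrs s aptr) + 50 * (n - size vis) + 50 * size (up (vars s vu)).

Lemma searching_pop vis up s : searching vis up s -> vars s vu < n ->
  off (vars s vu).+1 <= arrs s aptr (vars s vu) ->
  searching vis up (set_var s vu (arrs s apar (vars s vu))) /\
  potential vis up (set_var s vu (arrs s apar (vars s vu))) + 50 <= potential vis up s.
Proof.
move=> D un full; have [] := D; set u := vars s vu in un full *.
move=> dk duq dlt dx dxin dnum dord dparx dpar dup dup0 dupvis du dadj dptr dnew dseen dfin.
have uv : u \in vis by case/orP: du => // /eqP uE; rewrite -/u uE ltnn in un.
have upu : up u = u :: up (arrs s apar u).
  by rewrite dup //; case: eqP => // ->; rewrite dparx dup0.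
split; last by rewrite /potential /= /upd /= -/u upu /=; lia.
constructor => //=; rewrite /upd /=.
  have [->|ux] := eqVneq u x; first by rewrite dparx eqxx.
  by have [-> _ _] := dpar u uv ux; rewrite orbT.
move=> v vv vup; have [->|vu] := eqVneq v u.
  by apply/eqP; rewrite eqn_leq full andbT; have /andP[] := dptr u un.
by apply: dfin => //; rewrite -/u upu inE negb_or vu.
Qed.

(** A discovered node off the stack has scanned its whole list, and scanned neighbours are
    discovered. This is what rules out cross edges. *)
Lemma mem_vis_full vis up s v w : searching vis up s -> v \in vis ->
  v \notin up (vars s vu) -> E v w -> w \in vis.
Proof.
move=> D vv vup Evw; have [k kr <-] := csr_ex G Evw.
by apply: (d_seen D vv); rewrite (d_fin D).
Qed.

(** This and [discovered] copy the updates of [dfs_body] literally, so that they match the goals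
    produced by [wp] up to conversion. *)
Definition advance s :=
  set_cell (set_var s vw (arrs s aadj (arrs s aptr (vars s vu)))) aptr (vars s vu)
    (arrs s aptr (vars s vu)).+1.

Definition discovered s w :=
  set_var (set_var (set_cell (set_cell (set_cell s apar w (vars s vu))
    anum w (vars s vk)) aord (vars s vk) w) vk (vars s vk).+1) vu w.

Lemma searching_advance vis up s : searching vis up s -> vars s vu < n ->
  arrs s aptr (vars s vu) < off (vars s vu).+1 ->
  adj (arrs s aptr (vars s vu)) \in vis ->
  searching vis up (advance s) /\
  potential vis up (advance s) + 100 <= potential vis up s.
Proof.
move=> D un lt wv; have [] := D; set u := vars s vu in un lt wv *.
move=> dk duq dlt dx dxin dnum dord dparx dpar dup dup0 dupvis du dadj dptr dnew dseen dfin.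
have uv : u \in vis by case/orP: du => // /eqP uE; rewrite -/u uE ltnn in un.
split; last first.
  rewrite /potential /advance /= upd_same [upd (vars s) _ _ _]/upd /= -/u.
  by rewrite -(todo_next un lt); lia.
constructor => //=; rewrite /upd /=.
- move=> v ltv; case: eqP => [->|_]; last exact: dptr.
  rewrite -/u lt andbT; have /andP[ge _] := dptr u un; exact: leq_trans ge (leqnSn _).
- by move=> v ltv vv; case: eqP => [vE|_]; [rewrite vE uv in vv | exact: dnew].
- move=> v k vv; case: eqP => [->|_]; last exact: dseen.
  rewrite ltnS => /andP[ge]; rewrite leq_eqVlt => /orP[/eqP -> //|ltk].
  by apply: dseen uv _; rewrite ge.
- move=> v vv vup; case: eqP => [vE|_]; last exact: dfin.
  by move: vup; rewrite vE dup // mem_head.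
Qed.
Lemma size_vis vis up s w : searching vis up s -> w < n -> w \notin vis -> size vis < n.
Proof.
move=> D wn wv; rewrite -(size_iota 0 n); apply: (@uniq_leq_size _ (w :: vis)).
  by rewrite /= wv (d_uniq D).
move=> v; rewrite inE mem_iota => /orP[/eqP -> //|]; exact: allP (d_lt D) v.
Qed.

Lemma size_vis_le vis up s : searching vis up s -> size vis <= n.
Proof.
move=> D; rewrite -(size_iota 0 n); apply: uniq_leq_size (d_uniq D) _ => v.
by rewrite mem_iota; apply: allP (d_lt D) v.
Qed.

Lemma searching_discover vis up s : searching vis up s -> vars s vu < n ->
  arrs s aptr (vars s vu) < off (vars s vu).+1 ->
  let w := adj (arrs s aptr (vars s vu)) in w \notin vis ->
  let vis' := rcons vis w in let up' := upd up w (w :: up (vars s vu)) in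
  searching vis' up' (discovered (advance s) w) /\
  potential vis' up' (discovered (advance s) w) + 100 <= potential vis up s.
Proof.
move=> D un lt w; have [] := D; set u := vars s vu in un lt w *.
move=> dk duq dlt dx dxin dnum dord dparx dpar dup dup0 dupvis du dadj dptr dnew dseen dfin.
move=> wv vis' up'.
have uv : u \in vis by case/orP: du => // /eqP uE; rewrite -/u uE ltnn in un.
have Euw : E u w by apply: (csr_adj G) => //; have /andP[-> _] := dptr u un.
have wn : w < n by rewrite (csr_sym G) in Euw; apply: csr_lt G _ _ Euw.
have sv := size_vis D wn wv.
have neqw v : v \in vis -> (v == w) = false by move=> vv; apply: contraNF wv => /eqP <-.
have memv v : (v \in vis') = (v == w) || (v \in vis) by rewrite mem_rcons inE.
have idx v : v \in vis -> index v vis' = index v vis.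
  by move=> vv; rewrite /vis' -cats1 index_cat vv.
have idxw : index w vis' = size vis.
  by rewrite /vis' -cats1 index_cat (negPf wv) /= eqxx addn0.
have xw : (x == w) = false by apply: neqw.
have upn : up' n = [::] by rewrite /up' /upd; case: eqP => // wE; rewrite -wE ltnn in wn.
have upv v : v \in vis -> up' v = up v by move=> vv; rewrite /up' /upd neqw.
have upw : up' w = w :: up u by rewrite /up' upd_same.
(* A discovered neighbour of the new node [w] is still on the stack, or else [w] would have been
   discovered already; hence it is an ancestor of [w]. *)
have onstack v : v \in vis -> E v w -> v \in up' w.
  move=> vv Evw; rewrite upw inE; apply/orP; right; apply: contraNT wv => vu.
  exact: mem_vis_full D vv vu Evw.
have size_ : size vis' = (size vis).+1 by rewrite size_rcons.
split; last first.
  rewrite /potential /discovered /advance /= {1 2 3 4 5}/upd /= -/w upw size_ /=.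
  have := todo_next un lt; rewrite /upd /= -/u; lia.
constructor; rewrite /= /upd ?eqxx /=.
- by rewrite size_ dk.
- by rewrite rcons_uniq wv.
- by rewrite all_rcons wn.
- by rewrite nth_rcons; case: (vis) dxin dx.
- by rewrite memv dxin orbT.
- move=> v ltv; rewrite memv; case: eqP => [->|_] /=; first by rewrite idxw.
  by rewrite dnum //; case: ifP => // vv; rewrite idx.
- move=> k; rewrite size_ ltnS dk nth_rcons leq_eqVlt; case: eqP => [->|_] /=.
    by rewrite ltnn.
  by move=> /[dup] ltk ->; rewrite dord.
- by rewrite xw.
- move=> v; rewrite memv; case: eqP => [-> _ wx|_ /= vv vx].
    by rewrite memv -/u uv orbT idxw idx // index_mem.
  by have [pv ltp Ep] := dpar v vv vx; rewrite memv pv orbT !idx.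
- move=> v; rewrite memv; case: eqP => [-> _|_ /= vv].
    by rewrite upw eq_sym xw -/u (upv u uv).
  rewrite upv // dup //; case: (v =P x) => // /eqP vx.
  by have [pv _ _] := dpar v vv vx; rewrite upv.
- exact: upn.
- move=> v a; rewrite memv; case: eqP => [-> _|_ /= vv].
    by rewrite upw inE memv => /orP[->//|/(dupvis _ _ uv) ->]; rewrite orbT.
  by rewrite upv // memv => /(dupvis _ _ vv) ->; rewrite orbT.
- by rewrite memv eqxx orbT.
- move=> v a; rewrite !memv; case: eqP => [-> _|_ /= vv]; case: eqP => [->|_ /= av].
  + by rewrite upw mem_head.
  + by rewrite (csr_sym G) => Eaw; rewrite (onstack _ av Eaw) orbT.
  + by move=> _ Evw; rewrite (onstack _ vv Evw).
  + by rewrite !upv //; apply: dadj.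
- move=> v ltv; case: eqP => [->|_]; last exact: dptr.
  by rewrite -/u lt andbT; have /andP[ge _] := dptr u un; apply: leq_trans ge (leqnSn _).
- move=> v ltv; rewrite memv => /norP[vw vv]; case: eqP => [vE|_]; last exact: dnew.
  by rewrite vE -/u uv in vv.
- move=> v k; rewrite !memv; case: (v =P w) => [-> _|_ /= vv].
    rewrite -/u [w == u]eq_sym neqw // dnew // => /andP[ge].
    by rewrite ltnNge ge.
  case: eqP => [->|_ /(dseen _ _ vv) ->]; last by rewrite orbT.
  rewrite ltnS => /andP[ge]; rewrite leq_eqVlt => /orP[/eqP ->|ltk].
    by rewrite -/u -/w eqxx.
  by rewrite (dseen u) ?orbT // ge.
- move=> v; rewrite memv => vv; rewrite -/w upw inE negb_or => /andP[vw vu].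
  have {}vv : v \in vis by rewrite (negPf vw) in vv.
  by case: eqP => [vE|_]; [rewrite vE dup // mem_head in vu | exact: dfin].
Qed.

Lemma dfs_loop_spec s up0 : loaded s ->
  searching [:: x] up0 s ->
  spec dfs_loop s (fun t s' => [/\ same dfs_loop s s',
    t <= 100 * todo (arrs s aptr) + 50 * n + 50 * size (up0 (vars s vu)) + 10 &
    exists up, searched x (arrs s' apar) (arrs s' anum) (arrs s' aord) up]).
Proof.
move=> [sn soff sadj] D0.
pose I m s1 := exists vis up, searching vis up s1 /\ potential vis up s1 = m.
apply: spec_weaken (@spec_while_pot _ _ _ I (potential [:: x] up0 s) _ _) _.
- by exists [:: x], up0.
- move=> m s1 [sv sa] [vis [up [D <-]]] /=; rewrite (sv vn) // sn => un.
  have off1 : arrs s1 aoff = off by rewrite sa.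
  have adj1 : arrs s1 aadj = adj by rewrite sa.
  have sn1 : vars s1 vn = n by rewrite sv.
  pose Q s2 := exists vis' up',
    searching vis' up' s2 /\ potential vis' up' s2 + 50 <= potential vis up s1.
  suff W : wp dfs_body Q s1.
    apply: spec_weaken (wp_spec W) _ => t s2 [le [vis' [up' [D' le']]]].
    exists (potential vis' up' s2); first by exists vis', up'.
    by move: le le' => /=; lia.
  split=> /=; rewrite off1; last first.
    by rewrite -leqNgt => /(searching_pop D un)[D2 le2]; exists vis, up.
  move=> lt; set s2 := advance s1.
  have w2 : vars s2 vw = adj (arrs s1 aptr (vars s1 vu)) by rewrite /s2 /= adj1.
  have [wn uv] : vars s2 vw < n /\ vars s1 vu \in vis.
    have uv : vars s1 vu \in vis.
      by case/orP: (d_u D) => // /eqP uE; rewrite uE ltnn in un.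
    split=> //; rewrite w2; have : E (vars s1 vu) (adj (arrs s1 aptr (vars s1 vu))).
      by apply: (csr_adj G) => //; have /andP[-> _] := d_ptr D un.
    by rewrite (csr_sym G) => /(csr_lt G).
  have num2 : arrs s2 anum (vars s2 vw) =
      if vars s2 vw \in vis then index (vars s2 vw) vis else n by rewrite -(d_num D).
  have n2 : vars s2 vn = n by rewrite -sn1.
  change ((arrs s2 anum (vars s2 vw) == vars s2 vn -> Q (discovered s2 (vars s2 vw))) /\
          (arrs s2 anum (vars s2 vw) != vars s2 vn -> Q s2)).
  (* Positions in [vis] are below [size vis <= n], so the stored value [n] identifies exactly the
     undiscovered nodes. *)
  have -> : (arrs s2 anum (vars s2 vw) == vars s2 vn) = (vars s2 vw \notin vis).
    rewrite num2 n2; case: ifP => wv; last by rewrite eqxx.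
    by rewrite ltn_eqF // (leq_trans _ (size_vis_le D)) // index_mem.
  split=> [wv|/negPn wv]; rewrite w2 in wv.
    have [D2 le2] := searching_discover D un lt wv.
    by rewrite -w2 in D2 le2; do 2 eexists; split; [exact: D2 | apply: leq_trans le2; rewrite leq_add2l].
  have [D2 le2] := searching_advance D un lt wv.
  by exists vis, up; split=> //; apply: leq_trans le2; rewrite leq_add2l.
move=> t s2 [sm [m [vis [up [D _]]]] /= + let_]; have [sv sa] := sm.
rewrite (sv vn) // sn -leqNgt => ge2; split=> //; first by move: let_; rewrite /potential /=; lia.
have uE : vars s2 vu = n.
  by have [/eqP//|uv] := orP (d_u D); have := allP (d_lt D) _ uv; rewrite ltnNge ge2.
(* The stack being empty, every discovered node is exhausted; so [vis] is closed under edges and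
   contains all nodes by connectivity. *)
have all_vis v : v < n -> v \in vis.
  move: v; apply: conn => [|v w vv Evw]; first exact: d_xin D.
  by apply: (mem_vis_full D vv _ Evw); rewrite uE (d_up0 D).
have sizeE : size vis = n.
  apply/eqP; rewrite eqn_leq (size_vis_le D) /= -{1}(size_iota 0 n).
  by apply: uniq_leq_size (iota_uniq _ _) _ => v; rewrite mem_iota => /andP[_ /all_vis].
have numE v : v < n -> arrs s2 anum v = index v vis.
  by move=> ltv; rewrite (d_num D) // all_vis.
exists up; split.
- move=> v ltv; rewrite numE //; have vv := all_vis v ltv.
  have lti : index v vis < size vis by rewrite index_mem.
  by split; [rewrite -sizeE | rewrite (d_ord D) // nth_index].
- move=> k; rewrite -sizeE => ltk; rewrite (d_ord D) // sizeE.
  have lt : nth 0 vis k < n by apply: (allP (d_lt D)); apply: mem_nth.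
  by rewrite numE // index_uniq // (d_uniq D).
- rewrite numE // -(d_x D) index_uniq ?(d_uniq D) //.
  by rewrite sizeE; apply: leq_ltn_trans xn.
- exact: d_parx D.
- move=> v ltv vx; have [pv ltp Ep] := d_par D (all_vis v ltv) vx.
  by rewrite !numE // (allP (d_lt D)).
- by move=> v ltv; apply: d_up D _ (all_vis v ltv).
- move=> v w Evw; have vn_ := csr_lt G Evw.
  have wn : w < n by rewrite (csr_sym G) in Evw; apply: csr_lt G _ _ Evw.
  exact: d_adj D v w (all_vis v vn_) (all_vis w wn) Evw.
Qed.
End DepthFirst.
End Search.

(** * Lowpoints and blocks *)

Definition low_inner_body :=
  Assign vw (Get aadj (Var vk)) ;;
  If (And (Not (Eq (Var vw) (Var vx))) (Not (Eq (Var vw) (Get apar (Var vu)))))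
    (If (Eq (Get apar (Var vw)) (Var vu))
       (Assign vval (Get alow (Var vw))) (Assign vval (Get anum (Var vw))) ;;
     If (Lt (Var vval) (Get alow (Var vu))) (Put alow (Var vu) (Var vval)) Skip)
    Skip ;;
  incr vk.
Definition low_inner := While (Lt (Var vk) (Get aoff (Succ (Var vu)))) low_inner_body.
Definition low_head :=
  Assign vi (Pred (Var vi)) ;;
  Assign vu (Get aord (Var vi)) ;;
  Put alow (Var vu) (Var vi) ;;
  Assign vk (Get aoff (Var vu)).
(** Numbers decrease, so that children are finished first. As [vi] is decremented before its use,
    the test [1 < vi] covers the numbers from [n - 1] down to 1 and leaves out the root. *)
Definition low_loop := While (Lt (Const 1) (Var vi)) (low_head ;; low_inner).

Section Low.
Variables (n : nat) (off adj : nat -> nat) (E : rel nat).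
Hypothesis G : csr n off adj E.
Variables (x : nat) (par num ord : nat -> nat) (up : nat -> seq nat).
Hypotheses (xn : x < n) (T : searched n E x par num ord up).

Definition relevant_at v w := (w != x) && (w != par v).
Definition via_at (low : nat -> nat) v w := if par w == v then low w else num w.

Definition low_ok (low : nat -> nat) v :=
  [/\ low v <= num v,
    forall w, E v w -> relevant_at v w -> low v <= via_at low v w &
    low v = num v \/ exists w, [/\ E v w, relevant_at v w & low v = via_at low v w]].

Definition tree_loaded s :=
  [/\ loaded n off adj s, vars s vx = x, arrs s apar = par, arrs s anum = num &
    arrs s aord = ord].

Lemma tree_loaded_same p s s' : same p s s' ->
  ~~ [|| wvar p vn, wvar p vx, warr p aoff, warr p aadj, warr p apar, warr p anum | warr p aord] ->
  tree_loaded s -> tree_loaded s'.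
Proof.
move=> [sv sa] /norP[? /norP[? /norP[? /norP[? /norP[? /norP[? ?]]]]]] [[h1 h2 h3] h4 h5 h6 h7].
by split; rewrite ?(sv vx) ?(sa apar) ?(sa anum) ?(sa aord) //; split; rewrite ?(sv vn) ?(sa aoff) ?(sa aadj).
Qed.

Lemma par_neq v : v < n -> v != x -> par v != v.
Proof. by move=> vn_ vx; have [_ + _] := s_par T vn_ vx; apply: contraTneq => ->; rewrite ltnn. Qed.

Lemma num_inj_lt v w : v < n -> w < n -> num v = num w -> v = w.
Proof. by move=> /(s_num T)[_ {2}<-] /(s_num T)[_ {2}<-] ->. Qed.

Lemma low_inner_spec s u : tree_loaded s -> u < n -> u != x ->
  vars s vu = u -> vars s vk = off u -> arrs s alow u = num u ->
  spec low_inner s (fun t s' => [/\ same low_inner s s',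
    t <= 50 * (off u.+1 - off u) + 10,
    forall w, w != u -> arrs s' alow w = arrs s alow w &
    low_ok (arrs s' alow) u]).
Proof.
move=> TL un ux su sk slow.
pose K k low := [/\ off u <= k <= off u.+1,
  forall w, w != u -> low w = arrs s alow w,
  low u <= num u,
  forall j, off u <= j < k -> relevant_at u (adj j) -> low u <= via_at low u (adj j) &
  low u = num u \/ exists w, [/\ E u w, relevant_at u w & low u = via_at low u w]].
pose I s1 := K (vars s1 vk) (arrs s1 alow).
(* A node is not its own parent, so updating [low u] does not disturb the values that it is compared
   with. *)
have viaE f g w : (forall w, w != u -> f w = g w) -> via_at f u w = via_at g u w.
  move=> fg; rewrite /via_at; case: eqP => // pw; apply: fg.
  by apply/eqP => wE; have := par_neq un ux; rewrite -{1}wE pw eqxx.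
have next k low low' : K k low -> k < off u.+1 ->
    (forall w, w != u -> low' w = low w) -> low' u <= low u ->
    (relevant_at u (adj k) -> low' u <= via_at low u (adj k)) ->
    (low' u = low u \/ relevant_at u (adj k) /\ low' u = via_at low u (adj k)) -> K k.+1 low'.
  move=> [/andP[k1 k2] K2 K3 K4 K5] ltk same_ le lew att.
  have vE w : via_at low' u w = via_at low u w by apply: viaE.
  split.
  - by rewrite ltk andbT leqW.
  - by move=> w wu; rewrite same_ // K2.
  - exact: leq_trans le K3.
  - move=> j /andP[j1]; rewrite ltnS leq_eqVlt vE => /orP[/eqP ->//|j2 r].
    by apply: leq_trans le (K4 j _ r); rewrite j1.
  - case: att => [->|[r lE]].
      case: K5 => [->|[w [Ew rw lE]]]; [by left | right].
      by exists w; rewrite vE.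
    right; exists (adj k); rewrite vE; split=> //; apply: (csr_adj G) => //.
    by rewrite k1.
apply: spec_weaken (@spec_while_wp _ _ s I (fun s1 => 50 * (off u.+1 - vars s1 vk)) _ _) _.
- rewrite /I /K sk slow leqnn (csr_le G) //; split=> //; last by left.
  by move=> j; rewrite ltnNge; case/andP=> ->.
- move=> s1 sm I1 /=; have [sv sa] := sm.
  have [[h1 h2 h3] h4 h5 h6 h7] : tree_loaded s1 by apply: tree_loaded_same sm _ TL.
  rewrite h2 (sv vu) // su => ltk.
  rewrite /upd /= h3 h4 h5 h6 (sv vu) // su.
  have bound L : K (vars s1 vk).+1 L -> K (vars s1 vk).+1 L /\
     wcost low_inner_body + (1 + 4).+1 + 50 * (off u.+1 - (vars s1 vk).+1) <= 50 * (off u.+1 - vars s1 vk).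
    by split=> //=; lia.
  have nx := next _ _ _ I1 ltk.
  split=> [r|nr].
    set a := adj _ in r nx *.
    have up_leaf val : via_at (arrs s1 alow) u a = val -> val < arrs s1 alow u ->
        K (vars s1 vk).+1 (upd (arrs s1 alow) u val).
      move=> vE lt; apply: nx; rewrite ?upd_same ?vE //; last by right.
        by move=> w wu; rewrite /upd (negPf wu).
      exact: ltnW.
    have skip_leaf val : via_at (arrs s1 alow) u a = val -> ~~ (val < arrs s1 alow u) ->
        K (vars s1 vk).+1 (arrs s1 alow).
      by move=> vE; rewrite -leqNgt => le; apply: nx; rewrite ?vE //; left.
    split=> pw; split=> lt.
    - by apply: bound; apply: up_leaf lt; rewrite /via_at pw.
    - by apply: bound; apply: skip_leaf lt; rewrite /via_at pw.
    - by apply: bound; apply: up_leaf lt; rewrite /via_at (negPf pw).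
    - by apply: bound; apply: skip_leaf lt; rewrite /via_at (negPf pw).
  apply: (bound (arrs s1 alow)); apply: nx => //; last by left.
  by move=> r; rewrite /relevant_at in r; rewrite r in nr.
move=> t s2 [sm [_ I2 I3 I4 I5] /=]; have [sv sa] := sm.
have [[h1 h2 h3] h4 h5 h6 h7] : tree_loaded s2 by apply: tree_loaded_same sm _ TL.
rewrite h2 (sv vu) // su sk -leqNgt => ge le; split=> //; first by lia.
split=> // w Euw r; have [k /andP[k1 k2] kE] := csr_ex G Euw.
by rewrite -kE; apply: I4; rewrite ?kE // k1; apply: leq_trans ge.
Qed.
(** The condition at [v] reads [low] only at [v] and at children of [v], which have larger numbers;
    processing nodes of smaller number afterwards cannot break it. *)
Lemma low_ok_ext f g v : v < n -> v != x -> low_ok f v ->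
  (forall w, w < n -> num v <= num w -> g w = f w) -> low_ok g v.
Proof.
move=> vn_ vx [l1 l2 l3] fg.
have gv : g v = f v by apply: fg.
have vE w : E v w -> relevant_at v w -> via_at g v w = via_at f v w.
  move=> Evw /andP[wx _]; rewrite /via_at; case: eqP => // pw.
  have wn : w < n by rewrite (csr_sym G) in Evw; apply: csr_lt G _ _ Evw.
  apply: fg => //; have [_ + _] := s_par T wn wx; rewrite pw; exact: ltnW.
split; rewrite gv //; first by move=> w Ew r; rewrite vE // l2.
case: l3 => [->|[w [Ew r lE]]]; [by left | right].
by exists w; rewrite vE.
Qed.

(** The potential of the lowpoint pass: a constant for every node still to be processed, and a share
    for each cell of its row. *)
Definition below i := \sum_(v < n | num v < i) (100 + 100 * (off v.+1 - off v)).

Lemma below_step u : u < n ->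
  below (num u).+1 = 100 + 100 * (off u.+1 - off u) + below (num u).
Proof.
move=> un; rewrite /below (bigD1 (Ordinal un)) //=; congr (_ + _).
apply: eq_bigl => v; rewrite ltnS leq_eqVlt andb_orl.
have -> : (v != Ordinal un) = (num v != num u).
  congr (~~ _); apply/eqP/eqP => [-> //|nE]; apply/val_inj.
  exact: num_inj_lt (ltn_ord v) un nE.
by case: ltngtP.
Qed.

Lemma below_total : below n <= 100 * n + 100 * todo n off off.
Proof.
have -> : 100 * n + 100 * todo n off off = \sum_(v < n) (100 + 100 * (off v.+1 - off v)).
  by rewrite big_split /= sum_nat_const card_ord /todo big_distrr /= mulnC.
by rewrite /below [X in _ <= X](bigID (fun v : 'I_n => num v < n)) /= leq_addr.
Qed.

Lemma low_loop_spec s : tree_loaded s -> vars s vi = n ->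
  spec low_loop s (fun t s' => [/\ same low_loop s s',
    t <= 100 * n + 100 * todo n off off + 10 &
    forall v, v < n -> v != x -> low_ok (arrs s' alow) v]).
Proof.
move=> TL si.
pose I s1 := vars s1 vi <= n /\
  forall v, v < n -> v != x -> vars s1 vi <= num v -> low_ok (arrs s1 alow) v.
apply: spec_weaken (@spec_while _ _ s I (fun s1 => below (vars s1 vi)) _ _) _.
- rewrite /I si; split=> // v ltv _.
  by have [+ _] := s_num T ltv; rewrite ltnNge => /negPf ->.
- move=> s1 sm [le1 I1] /=; set i := vars s1 vi in le1 I1 * => lt1.
  have TL1 : tree_loaded s1 by apply: tree_loaded_same sm _ TL.
  have [[h1 h2 h3] h4 h5 h6 h7] := TL1.
  have [un nu] : ord i.-1 < n /\ num (ord i.-1) = i.-1 by apply: s_ord T _ _; lia.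
  set u := ord i.-1 in un nu.
  have ux : u != x by apply/eqP => uE; move: nu; rewrite uE (s_root T); lia.
  pose Q s2 := [/\ vars s2 vi = i.-1, vars s2 vu = u, vars s2 vk = off u &
    arrs s2 alow = upd (arrs s1 alow) u i.-1].
  have W : wp low_head Q s1 by rewrite /Q /= /upd /= h7 h2.
  apply: spec_seq (wp_spec W) _ => t s2 sm2 [let2 [i2 u2 k2 l2]].
  have TL2 : tree_loaded s2 by apply: tree_loaded_same sm2 _ TL1.
  have lu : arrs s2 alow u = num u by rewrite l2 upd_same.
  apply: spec_weaken (low_inner_spec TL2 un ux u2 k2 lu) _.
  move=> t3 s3 [[sv sa] let3 same3 ok3]; split.
    rewrite /I (sv vi) // i2; split; first by lia.
    move=> v ltv vx lev; have [->//|vu] := eqVneq v u.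
    have ltuv : i.-1 < num v.
      rewrite ltn_neqAle lev andbT -nu; apply: contra_neq vu => nE.
      by apply: num_inj_lt ltv un _; rewrite nE.
    apply: low_ok_ext (I1 v ltv vx _) _ => // [|w ltw lew]; first by lia.
    have wu : w != u by apply: contraTneq lew => ->; rewrite nu -ltnNge.
    by rewrite same3 // l2 /upd (negPf wu).
  have := below_step un; rewrite nu prednK ?(sv vi) // ?i2; last by lia.
  by move: let2 let3 => /=; lia.
move=> t s2 [sm [le2 I2] /=]; rewrite -leqNgt => ge let_; split=> //.
  by move: let_; rewrite si; have := below_total; lia.
move=> v ltv vx; apply: I2 => //; apply: leq_trans ge _.
rewrite lt0n; apply: contra vx => /eqP n0; apply/eqP.
by apply: num_inj_lt => //; rewrite (s_root T).
Qed.
End Low.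

(** Numbers increase, so that the head of the parent is known. When [u] opens a block, its flag
    starts as the mark of the top [par u], which no later visit would count in this block. This also
    resets the flags from one center to the next. *)
Definition head_find :=
  Assign vu (Get aord (Var vi)) ;;
  Assign vp (Get apar (Var vu)) ;;
  If (Lt (Get alow (Var vu)) (Get anum (Var vp)))
    (Assign vh (Get ahead (Var vp)))
    (Assign vh (Var vu) ;; Put aseen (Var vu) (Get amark (Var vp))) ;;
  Put ahead (Var vu) (Var vh).
Definition head_test :=
  If (Eq (Get amark (Var vu)) (Const 1))
    (If (And (Eq (Get aseen (Var vh)) (Const 1))
             (Not (Lt (Get anum (Get apar (Var vh))) (Get alow (Var vh)))))
       (Assign vres (Const 0)) Skip ;;
     Put aseen (Var vh) (Const 1))
    Skip ;;
  incr vi.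
Definition head_loop := While (Lt (Var vi) (Var vn)) (head_find ;; head_test).

Section Head.
Variables (n : nat) (off adj : nat -> nat) (E : rel nat).
Hypothesis G : csr n off adj E.
Variables (x : nat) (par num ord : nat -> nat) (up : nat -> seq nat) (low : nat -> nat).
Hypotheses (xn : x < n) (T : searched n E x par num ord up).

(** Fuel [n] suffices: each step to the parent lowers a number that starts below [n]. *)
Fixpoint hd_fuel k v :=
  if k is k'.+1 then if low v < num (par v) then hd_fuel k' (par v) else v else v.
Definition hd v := hd_fuel n v.

Lemma par_neq_root v : v < n -> v != x -> low v < num (par v) -> par v != x.
Proof. by move=> ? ?; apply: contraTneq => ->; rewrite (s_root T). Qed.

Lemma num_gt0 v : v < n -> v != x -> 0 < num v.
Proof.
move=> ltv; rewrite lt0n; apply: contra_neq => n0.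
by apply: num_inj_lt T _ _ _ _ _ => //; rewrite (s_root T).
Qed.

Lemma hd_fuel_eq k k' v : v < n -> v != x -> num v <= k -> num v <= k' ->
  hd_fuel k v = hd_fuel k' v.
Proof.
elim: k k' v => [|k IH] [|k'] v ltv vx; try by have := num_gt0 ltv vx; lia.
move=> lek lek' /=; case: ifP => // lt; have [pn ltp _] := s_par T ltv vx.
by apply: IH (par_neq_root ltv vx lt) _ _ => //; lia.
Qed.

Lemma hdE v : v < n -> v != x -> hd v = if low v < num (par v) then hd (par v) else v.
Proof.
move=> ltv vx; have [ltn_ _] := s_num T ltv; have [pn ltp _] := s_par T ltv vx.
rewrite {1}/hd (@hd_fuel_eq n n.+1) //=; last by rewrite ltnW // ltnW.
exact: ltnW.
Qed.

Lemma hd_facts v : v < n -> v != x ->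
  [/\ hd v < n, hd v != x, num (hd v) <= num v & hd (hd v) = hd v].
Proof.
have [k] := ubnP (num v); elim: k v => // k IH v ltk ltv vx.
have [pn ltp _] := s_par T ltv vx; rewrite (hdE ltv vx); case: ifP => lt.
  have [|h1 h2 h3 h4] := IH (par v) _ pn (par_neq_root ltv vx lt); first by lia.
  by split=> //; lia.
by rewrite (hdE ltv vx) lt.
Qed.

Definition inb h v := (v != x) && (hd v == h) || (v == par h).

Definition found i := exists h y z,
  [/\ h < n, h != x, hd h = h & low h <= num (par h)] /\
  [/\ y < n, z < n, y != z, E x y & E x z] /\
  [/\ inb h y, inb h z, num y < i & num z < i].

(** There are two bounds because [head_find] makes a new head known before [head_test] counts the
    node itself: in between, the heads are one step ahead of the nodes. *)
Definition seen_spec seen j i := forall h, h < n -> h != x -> hd h = h -> num h < j ->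
  (seen h == 1) <-> exists v, [/\ v < n, E x v, inb h v & num v < i].
Lemma inb_num h v : h < n -> h != x -> v < n -> inb h v -> v != par h -> num h <= num v.
Proof.
move=> hn hx ltv /orP[/andP[vx /eqP <-] _|->//].
by have [_ _ +] := hd_facts ltv vx.
Qed.

Lemma num_ltS i u v : u < n -> num u = i -> v < n ->
  (num v < i.+1) = (v == u) || (num v < i).
Proof.
move=> un <- vn_; rewrite ltnS leq_eqVlt; congr (_ || _).
by apply/eqP/eqP => [nE|-> //]; apply: (num_inj_lt T).
Qed.

(** Visiting [u] can complete a pair only in the block of [hd u]. Although [u] may also be the top
    of other blocks, the other nodes of these have larger numbers. *)
Lemma found_step i u : 0 < i -> u < n -> num u = i ->
  found i.+1 <-> found i \/ [/\ E x u, low (hd u) <= num (par (hd u)) &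
    exists v, [/\ v < n, E x v, inb (hd u) v & num v < i]].
Proof.
move=> i0 un nu.
have ux : u != x by apply: contraTneq i0 => uE; rewrite -nu uE (s_root T).
have [hn hx hle hh] := hd_facts un ux; rewrite nu in hle.
have same_head h v : h < n -> h != x -> inb h u -> v < n -> num v < i -> inb h v -> h = hd u.
  move=> h1 h2 /orP[/andP[_ /eqP //]|/eqP uE] vn_ lt hv.
  have [_ ltp _] := s_par T h1 h2; rewrite -uE nu in ltp.
  have /(inb_num h1 h2 vn_ hv) : v != par h by apply: contraTneq lt => ->; rewrite -uE nu ltnn.
  by move: ltp lt; lia.
split.
- case=> h [y [z [[h1 h2 h3 h4] [[y1 z1 yz Ey Ez] [hy hz]]]]].
  rewrite !(num_ltS un nu) // => /orP[/eqP yu|yi] /orP[/eqP zu|zi].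
  + by rewrite yu zu eqxx in yz.
  + right; rewrite yu in hy Ey; rewrite -(same_head h z) //; split=> //; by exists z.
  + right; rewrite zu in hz Ez; rewrite -(same_head h y) //; split=> //; by exists y.
  + by left; exists h, y, z.
- case=> [[h [y [z [H1 [H2 [hy hz yi zi]]]]]]|[Eu lowh [v [vn_ Ev hv vi_]]]].
    by exists h, y, z; split=> //; split=> //; split; rewrite // ltnS ltnW.
  exists (hd u), v, u; split=> //; split; split=> //; rewrite ?nu ?ltnS //; last exact: ltnW.
    by apply: contraTneq vi_ => ->; rewrite nu ltnn.
  by rewrite /inb ux eqxx.
Qed.

(** In a block just opened by [u], only the top is numbered below [u], so the initial flag is
    right. *)
Lemma seen_new seen i u : 0 < i -> u < n -> num u = i -> seen_spec seen i i ->
  (if hd u == u then seen u = E x (par u) :> nat else True) ->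
  seen_spec seen i.+1 i.
Proof.
move=> i0 un nu S su h hn hx hh; rewrite (num_ltS un nu) //.
case: (h =P u) => [hu _|_ /=]; last exact: S.
rewrite hu in hn hx hh *; rewrite hh eqxx in su; rewrite su eqb1.
have [pn ltp _] := s_par T hn hx.
split=> [Ep|[v [vn_ Ev hv vi_]]]; first by exists (par u); rewrite /inb eqxx orbT -nu.
have [<-//|/(inb_num hn hx vn_ hv)] := eqVneq v (par u).
by rewrite nu leqNgt vi_.
Qed.

Lemma seen_step seen seen' i u : 0 < i -> u < n -> num u = i ->
  seen_spec seen i.+1 i -> (forall h, h != hd u -> seen' h = seen h) ->
  seen' (hd u) = (if E x u then 1 else seen (hd u)) ->
  seen_spec seen' i.+1 i.+1.
Proof.
move=> i0 un nu S same_ su h hn hx hh ltj.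
have ux : u != x by apply: contraTneq i0 => uE; rewrite -nu uE (s_root T).
have [hE|hne] := eqVneq h (hd u); last first.
  rewrite same_ // (S h hn hx hh ltj); split=> -[v [vn_ Ev hv lt]].
    by exists v; split=> //; rewrite ltnS ltnW.
  exists v; split=> //; move: lt; rewrite (num_ltS un nu) // => /orP[/eqP vu|//].
  move: hv; rewrite vu => /orP[/andP[_ /eqP hE]|/eqP uE]; first by rewrite hE eqxx in hne.
  have [_ ltp _] := s_par T hn hx; move: ltp ltj; rewrite -uE nu; lia.
rewrite hE su; have := S (hd u); rewrite -hE => /(_ hn hx hh ltj) {}S.
case: ifP => [Eu|nEu].
  split=> // _; exists u; split=> //; first by rewrite hE /inb ux eqxx.
  by rewrite nu.
rewrite S; split=> -[v [vn_ Ev hv lt]]; exists v; split=> //; first by rewrite ltnS ltnW.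
by move: lt; rewrite (num_ltS un nu) // => /orP[/eqP vu|//]; rewrite vu nEu in Ev.
Qed.

Lemma head_loop_spec s : tree_loaded n off adj x par num ord s ->
  arrs s alow = low -> (forall v, v < n -> arrs s amark v = E x v) -> vars s vi = 1 ->
  spec head_loop s (fun t s' => [/\ same head_loop s s', t <= 100 * n + 10,
    vars s' vres = 0 <-> vars s vres = 0 \/ found n &
    vars s' vres = vars s vres \/ vars s' vres = 0]).
Proof.
move=> TL slow smark si.
pose I s1 := [/\ 0 < vars s1 vi <= n,
  forall v, v < n -> v != x -> num v < vars s1 vi -> arrs s1 ahead v = hd v,
  seen_spec (arrs s1 aseen) (vars s1 vi) (vars s1 vi),
  vars s1 vres = 0 <-> vars s vres = 0 \/ found (vars s1 vi) &
  vars s1 vres = vars s vres \/ vars s1 vres = 0].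
apply: spec_weaken (@spec_while _ _ s I (fun s1 => 100 * (n - vars s1 vi)) _ _) _.
(* Only the root is numbered below 1, which leaves no head and no pair of distinct nodes. *)
- rewrite /I si; split; [by lia | | | | by left].
  + by move=> v ltv /(num_gt0 ltv); lia.
  + by move=> h hn /(num_gt0 hn); lia.
  + split=> [|[//|[h [y [z [_ [[yn zn yz _ _] [_ _ yi zi]]]]]]]]; first by left.
    by case/eqP: yz; apply: (num_inj_lt T) => //; lia.
- move=> s1 sm [i1 I1 I2 I3 I4] /=; set i := vars s1 vi in i1 I1 I2 I3 I4 * => lti.
  have TL1 : tree_loaded n off adj x par num ord s1 by apply: tree_loaded_same sm _ TL.
  have [[h1 h2 h3] h4 h5 h6 h7] := TL1; rewrite h1 in lti.
  have [sv sa] := sm.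
  have low1 : arrs s1 alow = low by rewrite sa.
  have mark1 v : v < n -> arrs s1 amark v = E x v by move=> ltv; rewrite sa ?smark.
  have [un nu] : ord i < n /\ num (ord i) = i by apply: (s_ord T).
  set u := ord i in un nu; have i0 : 0 < i by case/andP: i1.
  have ux : u != x by apply: contraTneq i0 => uE; rewrite -nu uE (s_root T).
  have [pn ltp _] := s_par T un ux.
  pose Q s2 := [/\ vars s2 vu = u, vars s2 vh = hd u, arrs s2 ahead = upd (arrs s1 ahead) u (hd u) &
    seen_spec (arrs s2 aseen) i.+1 i].
  have W : wp head_find Q s1.
    have hE := hdE un ux.
    split=> /=; rewrite /Q /= /upd /= -/i h7 h5 h6 low1 -/u => lt.
      have hp : arrs s1 ahead (par u) = hd u.
        by rewrite I1 ?hE ?lt // ?(par_neq_root un ux) // -nu.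
      rewrite hp; split=> //; apply: (seen_new i0 un nu) => //; case: eqP => // hu.
      have [_ _ + _] := hd_facts pn (par_neq_root un ux lt).
      by move: hu; rewrite hE lt => ->; rewrite leqNgt ltp.
    have {}hE : hd u = u by rewrite hE (negPf lt).
    rewrite hE mark1 //; split=> //; apply: (seen_new i0 un nu) => //.
      move=> h hn hx hh hlt; rewrite -(I2 h hn hx hh hlt) /=; case: (h =P u) => // hu.
      by move: hlt; rewrite hu nu ltnn.
    by rewrite hE !eqxx.
  apply: spec_seq (wp_spec W) _ => t s2 sm2 [let2 [u2 vh2 l2 S2]].
  have TL2 : tree_loaded n off adj x par num ord s2 by apply: tree_loaded_same sm2 _ TL1.
  have [[g1 g2 g3] g4 g5 g6 g7] := TL2.
  have [sv2 sa2] := sm2.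
  have low2 : arrs s2 alow = low by rewrite sa2.
  have mark2 v : v < n -> arrs s2 amark v = E x v by move=> ltv; rewrite sa2 ?mark1.
  have i2 : vars s2 vi = i by rewrite sv2.
  have r2 : vars s2 vres = vars s1 vres by rewrite sv2.
  have [hn hx hle hh] := hd_facts un ux.
  have S2h := S2 (hd u) hn hx hh ltac:(by rewrite ltnS -nu).
  have fs := found_step i0 un nu.
  have head3 v : v < n -> v != x -> num v < i.+1 -> arrs s2 ahead v = hd v.
    move=> ltv vx; rewrite (num_ltS un nu) // l2 /upd; case: eqP => [-> //|_ /=].
    exact: I1.
  have concl res seen : seen_spec seen i.+1 i.+1 ->
      (res = 0 <-> vars s2 vres = 0 \/ [/\ E x u, low (hd u) <= num (par (hd u)) &
        exists v, [/\ v < n, E x v, inb (hd u) v & num v < i]]) ->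
      (res = vars s2 vres \/ res = 0) ->
      [/\ 0 < i.+1 <= n, forall v, v < n -> v != x -> num v < i.+1 -> arrs s2 ahead v = hd v,
        seen_spec seen i.+1 i.+1, res = 0 <-> vars s vres = 0 \/ found i.+1 &
        res = vars s vres \/ res = 0].
    move=> S3 resE res3; split=> //; last by case: res3 => [->|]; [rewrite r2 | right].
    by rewrite resE fs r2 I3; tauto.
  suff W2 : wp head_test (fun s3 => I s3 /\ vars s3 vi = i.+1) s2.
    apply: spec_weaken (wp_spec W2) _ => t3 s3 [let3 [I3' i3]]; split=> //.
    by rewrite i3; move: let2 let3 => /=; lia.
  rewrite /I /= /upd /= i2 u2 vh2 g5 g6 low2 mark2 // eqb1.
  split=> [Eu|nEu]; last first.
    split=> //; apply: concl; last by left.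
      by apply: (seen_step i0 un nu S2) => //; rewrite (negPf nEu).
    by split=> [|[//|[Eu]]]; [left | rewrite Eu in nEu].
  have S3 f : (forall h, h != hd u -> f h = arrs s2 aseen h) -> f (hd u) = 1 ->
      seen_spec f i.+1 i.+1.
    by move=> fh fu; apply: (seen_step i0 un nu S2) => //; rewrite Eu.
  have S3' : seen_spec (fun j => if j == hd u then 1 else arrs s2 aseen j) i.+1 i.+1.
    by apply: S3 => [h /negPf -> //|]; rewrite eqxx.
  rewrite -leqNgt; split=> [/andP[/S2h ex le]|no]; split=> //; apply: concl => //.
  + by split=> // _; right.
  + by right.
  + split=> [|[//|[_ le /S2h sh]]]; first by left.
    by rewrite sh le in no.
  + by left.
move=> t s2 [sm [i1 I1 I2 I3 I4] /= + let_]; have [sv _] := sm.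
have [[h1 _ _] _ _ _ _] := TL; rewrite (sv vn) // h1 -leqNgt => ge; split=> //.
  by move: let_; rewrite si; lia.
by have -> : n = vars s2 vi by lia.
Qed.
End Head.

(** * The recognition program *)

Definition dfs_setup :=
  Put anum (Var vx) (Const 0) ;;
  Put aord (Const 0) (Var vx) ;;
  Put apar (Var vx) (Var vn) ;;
  Assign vk (Const 1) ;;
  Assign vu (Var vx).

Definition check_node :=
  Assign vi (Const 0) ;; init_loop ;;
  Assign vi (Get aoff (Var vx)) ;; mark_loop ;;
  dfs_setup ;; dfs_loop ;;
  Assign vi (Var vn) ;; low_loop ;;
  Assign vi (Const 1) ;; head_loop ;;
  incr vx.

Definition recognize :=
  Assign vres (Const 1) ;; Assign vx (Const 0) ;;
  While (Lt (Var vx) (Var vn)) check_node ;;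
  Assign vn (Var vres).

Section Main.
Variables (n : nat) (off adj : nat -> nat) (E : rel nat).
Hypothesis G : csr n off adj E.
Hypothesis conn : forall x (S : pred nat), x < n ->
  S x -> (forall u v, S u -> E u v -> S v) -> forall v, v < n -> S v.
(** Abstract here, so that the program is verified on indices alone; it will be instantiated by the
    existence of a propeller centered at the node of index [x]. *)
Variable bad : nat -> Prop.
Hypothesis badP : forall x par num ord up low, x < n ->
  searched n E x par num ord up ->
  (forall v, v < n -> v != x -> low_ok E x par num low v) ->
  found n E x par num low n <-> bad x.

Local Notation total := (todo n off off).

Lemma loaded_same p s s' : same p s s' -> ~~ [|| wvar p vn, warr p aoff | warr p aadj] ->
  loaded n off adj s -> loaded n off adj s'.
Proof.
move=> [sv sa] /norP[? /norP[? ?]] [h1 h2 h3].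
by split; rewrite ?(sv vn) ?(sa aoff) ?(sa aadj).
Qed.

Lemma todo_le v : v < n -> off v.+1 - off v <= total.
Proof. by move=> ltv; rewrite /todo (bigD1 (Ordinal ltv)) //= leq_addr. Qed.

Lemma check_node_spec s x : loaded n off adj s -> vars s vx = x -> x < n ->
  spec check_node s (fun t s' => [/\
    t <= 400 * (n + total) + 200, vars s' vx = x.+1,
    vars s' vres = 0 <-> vars s vres = 0 \/ bad x &
    vars s' vres = vars s vres \/ vars s' vres = 0]).
Proof.
move=> L0 x0 xn.
have [t1 [s1 [r1 [c1 i1]]]] :
    spec (Assign vi (Const 0)) s (fun t s' => t <= 2 /\ vars s' vi = 0) by apply: wp_spec.
have sm1 := run_same r1; have L1 := loaded_same sm1 erefl L0.
have [t2 [s2 [r2 [_ c2 init2]]]] := init_loop_spec L1 i1.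
have sm2 := run_same r2; have L2 := loaded_same sm2 erefl L1.
have x2 : vars s2 vx = x by rewrite (proj1 sm2) // (proj1 sm1).
have [t3 [s3 [r3 [c3 i3]]]] : spec (Assign vi (Get aoff (Var vx))) s2
    (fun t s' => t <= 3 /\ vars s' vi = off x).
  by apply: wp_spec; rewrite /= /upd /= x2; case: L2 => _ ->.
have sm3 := run_same r3; have L3 := loaded_same sm3 erefl L2.
have x3 : vars s3 vx = x by rewrite (proj1 sm3).
have mark0 v : v < n -> arrs s3 amark v = 0.
  by move=> ltv; rewrite (proj2 sm3) //; case: (init2 v ltv).
have [t4 [s4 [r4 [_ c4 mark4]]]] := mark_loop_spec G L3 xn x3 i3 mark0.
have sm4 := run_same r4; have L4 := loaded_same sm4 erefl L3.
have x4 : vars s4 vx = x by rewrite (proj1 sm4).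
have init4 v : v < n -> arrs s4 aptr v = off v /\ arrs s4 anum v = n.
  by move=> /init2[pE nE _]; rewrite !(proj2 sm4) // !(proj2 sm3).
(* Before the search only the root is on the stack, and the sentinel [n] stands for the empty
   stack. *)
pose up0 v := if v == x then [:: x] else [::].
have [t5 [s5 [r5 [c5 [D5 u5]]]]] : spec dfs_setup s4 (fun t s' => t <= 20 /\
    (searching n off adj E x [:: x] up0 s' /\ vars s' vu = x)).
  have [n4 _ _] := L4.
  apply: spec_weaken (wp_spec (_ : wp dfs_setup _ s4)) _ => [|t s' [le H]]; last first.
    by split; [exact: leq_trans le _ | exact: H].
  rewrite /= /upd /= x4; split=> //; constructor=> //=; rewrite ?x4 ?n4 ?eqxx ?mem_head //.
  - by rewrite xn.
  - move=> v ltv; rewrite /upd /= inE [x == v]eq_sym; case: eqP => // _.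
    by case: (init4 v ltv).
  - by case=> // _; rewrite /upd.
  - by rewrite /upd /= eqxx.
  - by move=> v; rewrite inE => ->.
  - by move=> v; rewrite inE /up0 => /eqP ->; rewrite eqxx.
  - by rewrite /up0; case: eqP => // nx; rewrite nx ltnn in xn.
  - by move=> v w; rewrite inE /up0 => ->.
  - by rewrite /upd /= ?mem_head ?orbT.
  - by move=> v w; rewrite !inE /up0 => /eqP -> /eqP ->; rewrite eqxx mem_head.
  - by move=> v ltv; rewrite /upd /= (proj1 (init4 v ltv)) leqnn (csr_le G).
  - by move=> v ltv _; rewrite /upd /= (proj1 (init4 v ltv)).
  - move=> v k; rewrite inE /upd /= => /eqP ->; rewrite (proj1 (init4 x xn)).
    by rewrite ltnNge; case/andP=> ->.
  - by move=> v; rewrite /upd /= inE /up0 eqxx mem_seq1 => ->.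
have sm5 := run_same r5; have L5 := loaded_same sm5 erefl L4.
have todo5 : todo n off (arrs s5 aptr) = total.
  by apply: todo_ext => v /init4[<- _]; rewrite (proj2 sm5).
have [t6 [s6 [r6 [_ c6 [up T6]]]]] := dfs_loop_spec G xn (fun S => @conn x S xn) L5 D5.
have sm6 := run_same r6; have L6 := loaded_same sm6 erefl L5.
rewrite todo5 u5 /up0 eqxx /= in c6.
have x6 : vars s6 vx = x by rewrite (proj1 sm6) // (proj1 sm5).
set par := arrs s6 apar in T6; set num := arrs s6 anum in T6; set ord := arrs s6 aord in T6.
have [t7 [s7 [r7 [c7 i7]]]] : spec (Assign vi (Var vn)) s6
    (fun t s' => t <= 2 /\ vars s' vi = n).
  by apply: wp_spec; rewrite /= /upd /=; case: L6.
have sm7 := run_same r7; have L7 := loaded_same sm7 erefl L6.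
have TL7 : tree_loaded n off adj x par num ord s7.
  by split; rewrite ?(proj1 sm7) ?(proj2 sm7).
have [t8 [s8 [r8 [_ c8 low8]]]] := low_loop_spec G xn T6 TL7 i7.
have sm8 := run_same r8; have TL8 := tree_loaded_same sm8 erefl TL7.
have [t9 [s9 [r9 [c9 i9]]]] : spec (Assign vi (Const 1)) s8
    (fun t s' => t <= 2 /\ vars s' vi = 1) by apply: wp_spec.
have sm9 := run_same r9; have TL9 := tree_loaded_same sm9 erefl TL8.
have mark9 v : v < n -> arrs s9 amark v = E x v.
  move=> ltv; rewrite (proj2 sm9) // (proj2 sm8) // (proj2 sm7) // (proj2 sm6) // (proj2 sm5) //.
  exact: mark4.
have low9 : arrs s9 alow = arrs s8 alow by rewrite (proj2 sm9).
have [t10 [s10 [r10 [_ c10 res10 or10]]]] := head_loop_spec xn T6 TL9 low9 mark9 i9.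
have sm10 := run_same r10.
have res9 : vars s9 vres = vars s vres.
  rewrite (proj1 sm9) // (proj1 sm8) // (proj1 sm7) // (proj1 sm6) // (proj1 sm5) //.
  by rewrite (proj1 sm4) // (proj1 sm3) // (proj1 sm2) // (proj1 sm1).
have x10 : vars s10 vx = x by have [_ x9 _ _ _] := TL9; rewrite (proj1 sm10).
have [t11 [s11 [r11 [c11 [x11 res11]]]]] : spec (incr vx) s10
    (fun t s' => t <= 3 /\ (vars s' vx = x.+1 /\ vars s' vres = vars s10 vres)).
  by apply: wp_spec; rewrite /= /upd /= x10.
do 2 eexists; split.
  exact: RunSeq r1 (RunSeq r2 (RunSeq r3 (RunSeq r4 (RunSeq r5 (RunSeq r6 (RunSeq r7
    (RunSeq r8 (RunSeq r9 (RunSeq r10 r11))))))))).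
have B := badP xn T6 low8; rewrite res9 in res10 or10; split; rewrite ?res11 //.
  (* The row of [x] being at most [total], the loops take at most [280 * n + 230 * total]; the
     remaining constants add up to 122. *)
  by have := todo_le xn; lia.
by rewrite res10; tauto.
Qed.

Lemma recognize_spec s : loaded n off adj s -> 0 < n ->
  spec recognize s (fun t s' => t <= 1000 * (n * (n + total).+1) /\
    ((vars s' vn = 0 /\ exists2 x, x < n & bad x) \/
     (vars s' vn = 1 /\ forall x, x < n -> ~ bad x))).
Proof.
move=> L0 n0.
have [t1 [s1 [r1 [c1 [v1 x1]]]]] : spec (Assign vres (Const 1)) s
    (fun t s' => t <= 2 /\ (vars s' vres = 1 /\ True)) by apply: wp_spec.
have L1 := loaded_same (run_same r1) erefl L0.
have [t2 [s2 [r2 [c2 [v2 x2]]]]] : spec (Assign vx (Const 0)) s1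
    (fun t s' => t <= 2 /\ (vars s' vres = 1 /\ vars s' vx = 0)) by apply: wp_spec.
have L2 := loaded_same (run_same r2) erefl L1.
pose I s' := [/\ vars s' vx <= n,
  vars s' vres = 0 <-> exists2 x, x < vars s' vx & bad x &
  vars s' vres = 0 \/ vars s' vres = 1].
have [||t3 [s3 [r3 [sm3 [le3 I3 J3] /= + c3]]]] := @spec_while (Lt (Var vx) (Var vn)) check_node s2 I
    (fun s' => (n - vars s' vx) * (400 * (n + total) + 210)) _ _.
- by rewrite /I x2 v2; split=> //; [split=> // -[] | right].
- move=> s' sm [le I1 I2] /= lt; have L' := loaded_same sm erefl L2.
  have [n' _ _] := L'; rewrite n' in lt.
  apply: spec_weaken (check_node_spec L' erefl lt) _ => t s'' [ct x' res' or'].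
  split.
    rewrite /I x'; split=> //.
      rewrite res' I1; split=> [[[x ltx bx]|b]|[x]].
      + by exists x; rewrite // ltnS ltnW.
      + by exists (vars s' vx).
      rewrite ltnS leq_eqVlt => /orP[/eqP ->|ltx] bx; [by right | by left; exists x].
    by case: or' => ->; [exact: I2 | left].
  rewrite x' (_ : n - vars s' vx = (n - (vars s' vx).+1).+1); last by lia.
  by rewrite mulSn /=; lia.
have L3 := loaded_same sm3 erefl L2; have [n3 _ _] := L3; rewrite n3 -leqNgt => ge3.
have [t4 [s4 [r4 [c4 n4]]]] : spec (Assign vn (Var vres)) s3
    (fun t s' => t <= 2 /\ vars s' vn = vars s3 vres) by apply: wp_spec.
do 2 eexists; split; first exact: RunSeq r1 (RunSeq r2 (RunSeq r3 r4)).
have {ge3 le3} xE : vars s3 vx = n by apply/eqP; rewrite eqn_leq le3 ge3.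
split.
  (* Each of the [n] rounds costs at most [400 * (n + total) + 210]; the successor in the bound
     absorbs the constants, as [0 < n]. *)
  move: c3; rewrite x2 subn0 /= => c3; nia.
rewrite n4; rewrite xE in I3; case: J3 => resE; [left | right]; rewrite resE; split=> //.
  exact/I3.
by move=> x ltx bx; have /I3 : exists2 x, x < n & bad x by [exists x]; rewrite resE.
Qed.
End Main.

(** * Propellers *)

Definition has_propeller_at (G : sgraph) (x : G) :=
  exists y z, [/\ y != z, adj x y, adj x z & cocyclic (@adj G) (predC1 x) y z].

Section CycleWithCenter.
Variables (G : sgraph) (x : G) (C : seq G).
Hypotheses (uC : ucycle (@adj G) C) (sC : 2 < size C) (xC : x \notin C).

Definition wheel_node : finType := {y : G | y \in x :: C}.

(** Only the edges at the center and those between consecutive nodes of [C] are kept; dropping the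
    chords makes the rim chordless in the new graph. *)
Definition wheel_adj : rel wheel_node := fun a b =>
  adj (val a) (val b) && [|| val a == x, val b == x,
    next C (val a) == val b | next C (val b) == val a].

Lemma wheel_adj_sym : symmetric wheel_adj.
Proof.
move=> a b; rewrite /wheel_adj adj_sym orbCA; congr (_ && (_ || (_ || _))).
exact: orbC.
Qed.

Lemma wheel_adj_irr : irreflexive wheel_adj.
Proof. by move=> a; rewrite /wheel_adj adj_irr. Qed.

Definition wheel : sgraph := SGraph wheel_adj_sym wheel_adj_irr.

Definition hub : wheel := Sub x (mem_head x C).
Definition rim : seq wheel := map (insubd hub) C.

Lemma val_rim : map val rim = C.
Proof.
rewrite -map_comp -[RHS]map_id; apply/eq_in_map => y yC /=.
by rewrite val_insubd inE yC orbT.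
Qed.

Lemma mem_rim a : (a \in rim) = (val a \in C).
Proof. by rewrite -(mem_map val_inj) val_rim. Qed.

Lemma next_rim a : val (next rim a) = next C (val a).
Proof.
have uR : uniq rim by rewrite -(map_inj_uniq val_inj) val_rim; case/andP: uC.
by rewrite -(next_map val_inj uR) val_rim.
Qed.

Lemma wheel_propeller y z : y \in C -> z \in C -> y != z -> adj x y -> adj x z ->
  propeller rim hub.
Proof.
move=> yC zC yz xy xz.
have uR : uniq rim by rewrite -(map_inj_uniq val_inj) val_rim; case/andP: uC.
split.
- split; first by rewrite size_map.
    rewrite /ucycle uR andbT; apply: cycle_from_next => // a aR.
    rewrite /= /wheel_adj next_rim eqxx !orbT andbT.
    by apply: next_cycle; [case/andP: uC | rewrite -mem_rim].
  move=> a b aR bR /andP[_ /or4P[/eqP ax|/eqP bx|/eqP ab|/eqP ba]].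
  + by rewrite mem_rim ax (negPf xC) in aR.
  + by rewrite mem_rim bx (negPf xC) in bR.
  + by left; apply/val_inj; rewrite next_rim.
  + by right; apply/val_inj; rewrite next_rim.
- by rewrite mem_rim.
- move=> a; have := valP a; rewrite /= inE => /orP[/eqP ax|aC].
    by left; apply/val_inj.
  by right; rewrite mem_rim.
have nbr w : w \in C -> adj x w -> exists2 a : wheel, val a = w & a \in [set a in rim | adj hub a].
  move=> wC xw; have wxC : w \in x :: C by rewrite inE wC orbT.
  exists (Sub w wxC : wheel) => //.
  by rewrite inE mem_rim /= wC /wheel_adj /= xw eqxx.
have [a aE aA] := nbr y yC xy; have [b bE bA] := nbr z zC xz.
by apply/card_gt1P; exists a, b; rewrite aA bA -(inj_eq val_inj) aE bE.
Qed.
End CycleWithCenter.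

(** An embedding carries the rim to a cycle of [G], possibly with chords; conversely, [wheel] embeds
    in [G] by [val]. *)
Lemma propellerP (G : sgraph) :
  (exists (H : sgraph) (C : seq H) (x : H), propeller C x /\ subgraph H G) <->
  exists x : G, has_propeller_at x.
Proof.
split=> [[H [C [x [[[sC uC _] xC _ /card_gt1P[y [z [yA zA yz]]]] [f f_inj f_adj]]]]]|].
  move: yA zA; rewrite !inE => /andP[yC xy] /andP[zC xz].
  exists (f x), (f y), (f z); rewrite (inj_eq f_inj) !f_adj //; split=> //.
  exists (map f C); rewrite size_map !map_f //; split=> //.
    case/andP: uC => cC uC; rewrite /ucycle (map_inj_uniq f_inj) uC andbT.
    exact: homo_cycle cC.
  by apply/allP => _ /mapP[w wC ->] /=; rewrite (inj_eq f_inj); apply: contraNneq xC => <-.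
case=> x [y [z [yz xy xz [C [uC sC Cx yC zC]]]]].
have xC : x \notin C by apply/negP => /(allP Cx); rewrite /= eqxx.
exists (wheel x C), (rim x C), (hub x C); split; first exact: wheel_propeller yz xy xz.
by exists val => [|a b /andP[]] //; apply: val_inj.
Qed.

(** * From adjacency lists to arrays of indices, and back to nodes *)

Section Presentation.
Variables (G : sgraph) (vs : seq G) (N : G -> seq G).
Hypotheses (G2 : two_connected G) (P : presentation vs N).

Local Notation L := (rows vs N).
Local Notation n := (size vs).
Local Notation idx v := (index v vs).

Definition offset i := sumn (take i (map size L)).
Definition cell k := nth 0 (flatten L) k.
Definition edge : rel nat := fun i j => (i < n) && (j \in nth [::] L i).

Let uvs : uniq vs. Proof. by case: P. Qed.
Let vsT v : v \in vs. Proof. by case: P => _ + _; apply. Qed.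

Lemma idx_lt v : idx v < n.
Proof. by rewrite index_mem. Qed.

Lemma idx_inj : injective (fun v => idx v).
Proof. by move=> u v uv; rewrite -(nth_index u (vsT u)) uv nth_index. Qed.

Lemma idx_ex i : i < n -> exists v, idx v = i.
Proof.
case E : vs => [//|v0 vs']; rewrite -E => lti.
by exists (nth v0 vs i); rewrite index_uniq.
Qed.

Lemma row_idx v : nth [::] L (idx v) = [seq idx w | w <- N v].
Proof. by rewrite /rows (nth_map v) ?idx_lt // nth_index. Qed.

Lemma edge_idx u v : edge (idx u) (idx v) = adj u v.
Proof.
rewrite /edge idx_lt row_idx (mem_map idx_inj (N u) v).
by case: P => _ _ /(_ u)[_ ->].
Qed.

Lemma edge_ex i j : edge i j -> exists u v, [/\ i = idx u, j = idx v & adj u v].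
Proof.
case/andP=> /idx_ex[u <-]; rewrite row_idx => /mapP[v vN ->].
exists u, v; split=> //; case: P => _ _ /(_ u)[_ NE].
by rewrite NE in vN.
Qed.

Lemma offsetS i : i < n -> offset i.+1 = offset i + size (nth [::] L i).
Proof.
move=> lti; rewrite /offset (take_nth 0) ?size_map // sumn_rcons.
by rewrite (nth_map [::]) // size_map.
Qed.

Lemma cell_row i c : i < n -> c < size (nth [::] L i) ->
  cell (offset i + c) = nth 0 (nth [::] L i) c.
Proof.
move=> lti ltc; have sh : c < nth 0 (shape L) i by rewrite (nth_map [::]) // size_map.
by rewrite /cell -[offset i + c]/(flatten_index (shape L) i c) nth_flatten
  flatten_indexKl // flatten_indexKr.
Qed.

Lemma csr_presentation : csr n offset cell edge.
Proof.
split.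
- by move=> i lti; rewrite offsetS // leq_addr.
- move=> i k lti; rewrite offsetS // => /andP[/subnKC <-]; rewrite ltn_add2l => lt.
  by rewrite /edge lti cell_row // mem_nth.
- move=> i j /andP[lti jL]; exists (offset i + index j (nth [::] L i)).
    by rewrite leq_addr offsetS // ltn_add2l index_mem.
  by rewrite cell_row ?index_mem // nth_index.
- by move=> i j /andP[].
move=> i j; apply/idP/idP=> /edge_ex[u [v [-> -> uv]]]; by rewrite edge_idx adj_sym.
Qed.

Lemma input_loaded : loaded n offset cell (input vs N).
Proof. by []. Qed.

Lemma connectG (u v : G) : connect (@adj G) u v.
Proof.
have [] := G2 (S := set0); first by rewrite cards0.
case=> _ cn _; have mem0 w : w \notin (set0 : {set G}) by rewrite inE.
have /connectP[p pp lp] := cn (Sub u (mem0 u)) (Sub v (mem0 v)).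
apply/connectP; exists (map val p); last by rewrite -[u]/(val (Sub u (mem0 u) : del set0)) last_map -lp.
by rewrite -[u]/(val (Sub u (mem0 u) : del set0)) path_map.
Qed.

(** Take the first edge of a path to another node, which exists because [G] is not a single node. *)
Lemma degree_gt0 (u : G) : 0 < #|[pred w | adj u w]|.
Proof.
have [] := G2 (S := set0); first by rewrite cards0.
case=> card0 _ card1; have [v uv|all_u] := pickP (fun v => v != u).
  have /connectP[[|w p] /=] := connectG u v; first by move=> _ vu; rewrite vu eqxx in uv.
  by case/andP=> uw _ _; apply/card_gt0P; exists w.
case: card1; apply/eqP; rewrite eqn_leq card0 andbT; apply/card_le1_eqP => a b _ _.
by apply/val_inj; rewrite (eqP (negbFE (all_u (val a)))) (eqP (negbFE (all_u (val b)))).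
Qed.

Lemma conn_idx x (S : pred nat) : x < n -> S x ->
  (forall u v, S u -> edge u v -> S v) -> forall v, v < n -> S v.
Proof.
move=> /idx_ex[u <-] Su step _ /idx_ex[v <-].
have /connectP[p + ->] := connectG u v.
elim: p u Su => //= w p IH u Su /andP[uw]; apply: IH.
by apply: step Su _; rewrite edge_idx.
Qed.

Lemma total_sum : todo n offset offset = \sum_(v : G) #|[pred w | adj v w]|.
Proof.
rewrite /todo; transitivity (\sum_(v <- vs) size (N v)).
  transitivity (\sum_(r <- L) size r); last by rewrite big_map; apply: eq_bigr => v _; rewrite size_map.
  rewrite (big_nth [::]) size_map big_mkord; apply: eq_bigr => i _.
  by rewrite offsetS // addKn.
rewrite (perm_big (index_enum G)) /=; last first.
  by apply: uniq_perm => [||v]; rewrite ?index_enum_uniq // mem_index_enum vsT.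
apply: eq_bigr => v _; case: P => _ _ /(_ v)[uN NE].
by rewrite -(card_uniqP uN); apply: eq_card.
Qed.

(** An ordered pair of adjacent nodes is determined by its edge and a bit telling whether the first
    end has the smaller rank; the bit accounts for the factor 2. *)
Lemma total_edges : todo n offset offset <= 2 * #|edges G|.
Proof.
rewrite total_sum; under eq_bigr => v _ do rewrite -sum1_card.
rewrite pair_big_dep /= sum1_card.
pose f (p : G * G) := ([set p.1; p.2], enum_rank p.1 < enum_rank p.2).
rewrite -(@card_in_imset _ _ f) => [|[a b] [c d]].
  rewrite mulnC -card_bool -cardsT -cardsX; apply/subset_leq_card/subsetP => _ /imsetP[p pA ->].
  rewrite in_setX in_setT andbT; apply/imsetP; exists p => //; by move: pA; rewrite !inE.
rewrite /f => abA _ [sE rE]; have ab : adj a b := abA.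
have ab' : a != b by apply: contraTneq ab => ->; rewrite adj_irr.
have : (a \in [set c; d]) && (b \in [set c; d]) by rewrite -sE !inE !eqxx orbT.
rewrite !inE => /andP[/orP[/eqP ac|/eqP ad] /orP[/eqP bc|/eqP bd]].
- by rewrite ac bc eqxx in ab'.
- by rewrite ac bd.
- move: rE; rewrite ad bc.
  have /= : val (enum_rank c) != val (enum_rank d).
    by rewrite (inj_eq val_inj) (inj_eq enum_rank_inj) eq_sym -ad -bc.
  by case: ltngtP.
- by rewrite ad bd eqxx in ab'.
Qed.

Lemma size_total : n <= todo n offset offset.
Proof.
rewrite total_sum; have -> : n = \sum_(v : G) 1.
  by rewrite sum1_card; rewrite -(card_uniqP uvs); apply: eq_card => v; rewrite vsT.
by apply: leq_sum => v _; apply: degree_gt0.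
Qed.
(** The results of the search are transported from indices to nodes, where [cocyclicP] applies. The
    root's parent is the sentinel [n], no index of a node, hence the conditions [v != u] in the
    translations. *)
Lemma found_propeller u par num ord up low :
  searched n edge (idx u) par num ord up ->
  (forall v, v < n -> v != idx u -> low_ok edge (idx u) par num low v) ->
  found n edge (idx u) par num low n <-> has_propeller_at u.
Proof.
move=> T lows; pose node i := nth u vs i.
have idxK v : node (idx v) = v by apply: nth_index.
have nodeK i : i < n -> idx (node i) = i by move=> lti; apply: index_uniq.
have idx_eq v w : (idx v == idx w) = (v == w) by apply: (inj_eq idx_inj).
have nidx v : v != u -> idx v != idx u by rewrite idx_eq.
pose parG v := node (par (idx v)); pose numG v := num (idx v).
pose upG v := map node (up (idx v)); pose lowG v := low (idx v).
pose headG v := node (hd n par num low (idx v)).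
have parE v : v != u -> idx (parG v) = par (idx v).
  by move=> vu; apply: nodeK; case: (s_par T (idx_lt v) (nidx v vu)).
have par_eq v w : v != u -> (w == parG v) = (idx w == par (idx v)).
  by move=> vu; rewrite -idx_eq parE.
have treeG : dfs_tree (@adj G) u numG parG upG.
  split.
  - by move=> v w /(num_inj_lt T (idx_lt v) (idx_lt w)) /idx_inj.
  - by move=> v vu; rewrite /numG parE //; case: (s_par T (idx_lt v) (nidx v vu)).
  - by move=> v vu; rewrite -edge_idx parE //; case: (s_par T (idx_lt v) (nidx v vu)).
  - move=> v; rewrite /upG (s_up T (idx_lt v)) /= idxK idx_eq; congr cons.
    by have [//|vu] := eqVneq v u; rewrite parE.
  - move=> v w; rewrite -edge_idx => /(s_adj T)/orP[] /(map_f node);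
      by rewrite idxK /upG => ->; rewrite ?orbT.
have relE v w : v != u -> relevant u parG v w = relevant_at (idx u) par (idx v) (idx w).
  by move=> vu; rewrite /relevant /relevant_at idx_eq par_eq.
have viaE v w : w != u -> via numG parG lowG v w = via_at par num low (idx v) (idx w).
  by move=> wu; rewrite /via /via_at eq_sym par_eq // eq_sym.
have lowsG : low_spec (@adj G) u numG parG lowG.
  split=> [v vu|v w vu vw r|v vu]; have [l1 l2 l3] := lows _ (idx_lt v) (nidx v vu).
  - exact: l1.
  - have wu : w != u by case/andP: r.
    by rewrite viaE //; apply: l2; rewrite ?edge_idx // -relE.
  - case: l3 => [l3|[j [Evj r lE]]]; [by left | right].
    have [v' [w [vE jE vw]]] := edge_ex Evj; rewrite -(idx_inj vE) {}jE in vw r lE.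
    have wu : w != u by rewrite -idx_eq; case/andP: r.
    by exists w; rewrite relE // viaE.
have headE v : v != u -> idx (headG v) = hd n par num low (idx v).
  by move=> vu; apply: nodeK; case: (hd_facts low (idx_lt u) T (idx_lt v) (nidx v vu)).
have headsG : head_spec u numG parG lowG headG.
  move=> v vu; rewrite /headG (hdE low (idx_lt u) T (idx_lt v) (nidx v vu)) /numG parE // /lowG.
  by case: ifP; rewrite ?idxK.
have head_eq v h : v != u -> (headG v == h) = (hd n par num low (idx v) == idx h).
  by move=> vu; rewrite -idx_eq headE.
have blockE h v : h != u ->
    in_block u parG headG h v = inb n (idx u) par num low (idx h) (idx v).
  move=> hu; rewrite /in_block /inb idx_eq par_eq //.
  by have [//|vu] := eqVneq v u; rewrite head_eq.
have cyclicE h : h != u -> cyclic_block u numG parG lowG headG h =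
    (hd n par num low (idx h) == idx h) && (low (idx h) <= num (par (idx h))).
  by move=> hu; rewrite /cyclic_block hu head_eq // /lowG /numG parE.
split.
  case=> h' [y' [z' [[hn hx hh lh] [[yn zn yz Ey Ez] [hy hz _ _]]]]].
  move: (idx_ex hn) (idx_ex yn) (idx_ex zn) => [h hE] [y yE] [z zE].
  subst h' y' z'; rewrite idx_eq in hx; rewrite idx_eq in yz; rewrite !edge_idx in Ey Ez.
  exists y, z; split=> //.
  apply/(cocyclicP (@adj_sym G) (@adj_irr G) treeG lowsG headsG yz).
  by exists h; rewrite cyclicE // hh eqxx !blockE.
case=> y [z [yz uy uz]].
case/(cocyclicP (@adj_sym G) (@adj_irr G) treeG lowsG headsG yz) => h [ch By Bz].
have hu : h != u by case/and3P: ch.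
rewrite cyclicE // !blockE // in ch By Bz; case/andP: ch => /eqP hh lh.
exists (idx h), (idx y), (idx z); rewrite !edge_idx !idx_eq !idx_lt hu hh.
have num_lt v : num (idx v) < n by case: (s_num T (idx_lt v)).
by do !split.
Qed.
End Presentation.

Theorem theorem4p7 :
  exists (P : prog) (c : nat),
    forall (G : sgraph) (vs : seq G) (N : G -> seq G),
      two_connected G ->
      ~ (exists a b : G, K2_cutset a b) ->
      presentation vs N ->
      exists (t : nat) (s : memory),
        [/\ run P (input vs N) t s,
            class_C1 G -> output s = YES,
            ~ class_C1 G -> output s = NO &
            t <= c * (#|G| * #|edges G|)].
Proof.
(* The running time is at most 1000 times [n * (n + M + 1)], where [M] is the total length of the
   lists. With [m] edges, [0 < n <= M <= 2 * m] gives [n + M + 1 <= 4 * m + 1 <= 5 * m]. *)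
exists recognize, 5000 => G vs N G2 _ P.
pose bad i := exists2 u : G, index u vs = i & has_propeller_at u.
have nE : size vs = #|G|.
  by case: P => uvs vsT _; rewrite -(card_uniqP uvs); apply: eq_card => v; rewrite vsT.
have n0 : 0 < size vs.
  have [[/card_gt0P[v _] _] _] := G2 set0 ltac:(by rewrite cards0).
  by rewrite nE; apply/card_gt0P; exists (val v).
have [|t [s [r [le res]]]] := recognize_spec (csr_presentation P) (conn_idx G2 P)
  (bad := bad) _ (input_loaded vs N) n0.
  move=> x par num ord up low ltx; have [u <-] := idx_ex P ltx => T lows.
  rewrite (found_propeller P T lows); split=> [b|[v /(idx_inj P) <- //]].
  by exists u.
exists t, s; split=> //.
- move=> c1; case: res => [[_ [x ltx [u _ pu]]]|[]//].
  by case: c1; apply/propellerP; exists u.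
- move=> nc1; case: res => [[] //|[_ ok]]; case: nc1 => /propellerP[u pu].
  by apply: (ok (index u vs)); [exact: (idx_lt P) | exists u].
apply: leq_trans le _; rewrite -nE.
have := total_edges P; have := size_total G2 P; set M := todo _ _ _ => nM Me.
nia.
Qed.
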